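(* Let $(X,T)$ be a topological dynamical system (a compact metric space $(X,d)$ with a homeomorphism $T:X\to X$), let $f\in C(X,\mathbb{R})$, and let $\mu$ be an ergodic $T$-invariant Borel probability measure on $X$ with measure-theoretic entropy $h_{\mu}(T)>0$. Then for $\mu$-a.e. $x\in X$, $$\lim_{\epsilon\to 0}P_s(T,f,x,\epsilon)\geq P_{\mu}(T,f).$$
   Context: For $x\in X$ and $\epsilon>0$, the $\epsilon$-stable set is $W^s_{\epsilon}(x,T)=\{y\in X: d(T^nx,T^ny)\le\epsilon \text{ for all } n=0,1,2,\dots\}$. Write $f_n(x)=\sum_{i=0}^{n-1}f(T^ix)$ and $d_n(x,y)=\max_{0\le i\le n-1}d(T^ix,T^iy)$. A set $E\subseteq K$ is $(n,\delta)$-separated if distinct $x,y\in E$ satisfy $d_n(x,y)>\delta$. For a nonempty subset $K\subseteq X$ put $P_n(T,f,\delta,K)=\sup\{\sum_{x\in E}\exp f_n(x): E \text{ an } (n,\delta)\text{-separated subset of } K\}$. The topological pressure of the preimages of the $\epsilon$-stable set of $x$ is $$P_s(T,f,x,\epsilon)=\lim_{\delta\to0}\limsup_{n\to+\infty}\frac1n\log P_n(T,f,\delta,T^{-n}W^s_{\epsilon}(x,T)).$$ The measure-theoretic pressure is $P_{\mu}(T,f)=h_{\mu}(T)+\int_X f\,d\mu$. *)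

(* Defs.v *)
From HB Require Import structures.
From mathcomp Require Import all_boot all_order all_algebra.
From mathcomp Require Import all_classical all_reals all_analysis.

Set Implicit Arguments.
Unset Strict Implicit.
Unset Printing Implicit Defensive.

Import Order.TTheory GRing.Theory Num.Def Num.Theory.
Import numFieldTopology.Exports numFieldNormedType.Exports.
Local Open Scope classical_set_scope.
Local Open Scope ring_scope.

Section Defs.
Context {R : realType} {X : metricType R}.

(** A copy of X carrying a distinguished point [x0] (MathComp's measurable
    structures require a pointed carrier; [metricType] is not pointed). *)
Definition pX (x0 : X) : Type := X.
HB.instance Definition _ (x0 : X) := Choice.copy (pX x0) X.
HB.instance Definition _ (x0 : X) := isPointed.Build (pX x0) x0.

Variable x0 : X.
Local Notation borel_type := (g_sigma_algebraType (@open X : set (set (pX x0)))).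

Definition birk_sum (T : X -> X) (f : X -> R) (n : nat) (x : X) : R :=
  \sum_(i < n) f (iter i T x).

Definition bowen_dist (T : X -> X) (n : nat) (x y : X) : R :=
  \big[Num.max/0]_(i < n) mdist (iter i T x) (iter i T y).

Definition separated (T : X -> X) (n : nat) (delta : R) (K : set X)
    (E : seq X) : Prop :=
  uniq E /\ (forall x, x \in E -> K x) /\
  (forall x y, x \in E -> y \in E -> x != y -> delta < bowen_dist T n x y).

Definition Pn (T : X -> X) (f : X -> R) (delta : R) (K : set X) (n : nat)
    : \bar R :=
  ereal_sup [set (\sum_(x <- E) expR (birk_sum T f n x))%:E
            | E in separated T n delta K].

Definition eln (x : \bar R) : \bar R :=
  match x with
  | +oo%E => +oo%E
  | -oo%E => -oo%E
  | EFin r => if 0 < r then (ln r)%:E else -oo%E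
  end.

Definition stable_set (T : X -> X) (eps : R) (x : X) : set X :=
  [set y | forall n : nat, mdist (iter n T x) (iter n T y) <= eps].

Definition Ps (T : X -> X) (f : X -> R) (x : X) (eps : R) : \bar R :=
  lim (limn_esup (fun n : nat =>
            ((n%:R)^-1)%:E *
              eln (Pn T f delta ((iter n T) @^-1` stable_set T eps x) n))%E
       @[delta --> 0^'+]).

Definition measurable_partition (k : nat) (P : 'I_k -> set borel_type) : Prop :=
  (forall i, measurable (P i)) /\
  (forall i j, i != j -> P i `&` P j = set0) /\
  (\bigcup_(i in [set: 'I_k]) P i = [set: borel_type]).

Definition phi_ent (t : R) : R := if t == 0 then 0 else - (t * ln t).

Definition join_entropy (mu : probability borel_type R) (T : X -> X)
    (k : nat) (P : 'I_k -> set borel_type) (n : nat) : R :=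
  \sum_(w : {ffun 'I_n -> 'I_k})
     phi_ent (fine (mu (\bigcap_(i in [set: 'I_n]) ((iter i T) @^-1` P (w i))))).

Definition partition_entropy (mu : probability borel_type R) (T : X -> X)
    (k : nat) (P : 'I_k -> set borel_type) : R :=
  limn (fun n : nat => join_entropy mu T P n / n%:R).

Definition ms_entropy (mu : probability borel_type R) (T : X -> X) : \bar R :=
  ereal_sup [set (partition_entropy mu T (projT2 P))%:E
            | P in [set P : {k : nat & 'I_k -> set borel_type}
                   | measurable_partition (projT2 P)]].

Definition ms_pressure (mu : probability borel_type R) (T : X -> X)
    (f : X -> R) : \bar R :=
  (ms_entropy mu T + \int[mu]_x (f x)%:E)%E.

Definition invariant_measure (mu : probability borel_type R) (T : X -> X) :=
  forall A : set borel_type, measurable A -> mu (T @^-1` A) = mu A.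

Definition ergodic_measure (mu : probability borel_type R) (T : X -> X) :=
  forall A : set borel_type, measurable A -> T @^-1` A = A ->
    mu A = 0%E \/ mu A = 1%E.

Definition homeomorphism (T : X -> X) :=
  continuous T /\ exists Tinv : X -> X,
    [/\ cancel T Tinv, cancel Tinv T & continuous Tinv].

End Defs.

Notation borel_type X x0 := (g_sigma_algebraType (@open X : set (set (@pX _ X x0)))).

(* Main.v *)
(* Fix a finite partition P of small diameter.  The set of points sharing the
   infinite forward P-name of x lies in W^s_eps(x), so T^-n W^s_eps(x) contains
   the points z such that T^n z has the name of x.  Let Z_{n,m}(x) be the
   weighted number of n-names u whose cylinder meets T^-n of the m-cylinder of
   x.  Gibbs' inequality in each atom of T^-n (P v ... v T^-(m-1) P) gives
     int ln Z_{n,m} dmu >= H_{n+m} - H_m + n * int b dmu,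
   b being the weight of a letter, and by telescoping the right-hand side is at
   least about n * (h + int b) for infinitely many m.  As Z_{n,m} decreases with
   m and (ln Z_{n,m}) / n is bounded above, the set of x with
   (ln Z_{n,m}(x)) / n large for all m, and infinitely many n, has positive
   measure; compactness then turns names into points of T^-n W^s_eps(x).

   To pass from names to separated points, each atom is replaced by a compact
   subset, and the small remainders get the weight of f lowered by a large
   constant K: their total cost K * mu(remainder) stays small, while a
   (n, delta)-ball meets names of total weight at most (1 + #P * e^-K)^n.

   Finally the lower bound propagates along forward orbits, and by ergodicity
   almost every point has a backward orbit visiting a set of positive measure. *)

Require Import Defs.
From HB Require Import structures.
From mathcomp Require Import all_boot all_order all_algebra.
From mathcomp Require Import all_classical all_reals all_analysis.
From mathcomp Require Import measurable_realfun.
From mathcomp Require Import ring lra zify.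
Import Order.TTheory GRing.Theory Num.Def Num.Theory.
Import numFieldTopology.Exports numFieldNormedType.Exports.
Local Open Scope classical_set_scope.
Local Open Scope ring_scope.

Set Implicit Arguments.
Unset Strict Implicit.
Unset Printing Implicit Defensive.

(** * Entropy of finite partitions *)

Section entropy.
Context {R : realType}.

Lemma phi_ent0 : phi_ent (0 : R) = 0.
Proof. by rewrite /phi_ent eqxx. Qed.

(** Each [q j] is at most the total, so replacing [ln (q j)] by the logarithm of the total only
    lowers the sum. *)
Lemma phi_ent_sum_le {J : finType} (q : J -> R) : (forall j, 0 <= q j) ->
  phi_ent (\sum_j q j) <= \sum_j phi_ent (q j).
Proof.
move=> q0; rewrite {1}/phi_ent; case: ifPn => [/eqP s0|s0].
  have q0E j : q j = 0.
    apply/eqP; rewrite eq_le q0 andbT -s0 (bigD1 j)//= lerDl.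
    exact: sumr_ge0.
  by rewrite big1// => j _; rewrite q0E phi_ent0.
rewrite mulr_suml -sumrN; apply: ler_sum => j _; rewrite /phi_ent.
case: ifPn => [/eqP ->|qj0]; first by rewrite mul0r oppr0.
have qj : 0 < q j by rewrite lt_neqAle eq_sym qj0 q0.
rewrite lerN2 ler_wpM2l ?q0//.
have qs : q j <= \sum_j q j by rewrite (bigD1 j)//= lerDl; exact: sumr_ge0.
by rewrite ler_ln ?posrE// (lt_le_trans qj).
Qed.

(* Only the [j] with positive mass have to contribute to the partition
   function, since [ln] is bounded through [ln t <= t - 1] term by term. *)
Lemma gibbs_variational {J : finType} (q b : J -> R) (S : pred J) :
  (forall j, 0 <= q j) -> (forall j, 0 < q j -> S j) ->
  \sum_j (phi_ent (q j) + q j * b j) <=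
  phi_ent (\sum_j q j) + (\sum_j q j) * ln (\sum_(j | S j) expR (b j)).
Proof.
move=> q0 qS; set s := \sum_j q j; set Z := \sum_(j | S j) expR (b j).
have s_ge0 : 0 <= s by exact: sumr_ge0.
have [s0|s_neq0] := eqVneq s 0.
  rewrite s0 phi_ent0 mul0r addr0 big1// => j _.
  have -> : q j = 0.
    apply/eqP; rewrite eq_le q0 andbT -s0 /s (bigD1 j)//= lerDl.
    exact: sumr_ge0.
  by rewrite phi_ent0 mul0r addr0.
have sp : 0 < s by rewrite lt_neqAle eq_sym s_neq0.
have Zp : 0 < Z.
  have [j qj] : exists j, 0 < q j.
    apply/not_existsP => H; move: s_neq0; rewrite /s big1 ?eqxx// => j _.
    by apply/eqP; rewrite eq_le q0 andbT leNgt; apply/negP/H.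
  rewrite /Z (bigD1 j) ?qS//= ltr_wpDr ?expR_gt0//.
  by apply: sumr_ge0 => i _; exact: expR_ge0.
have term j : phi_ent (q j) + q j * b j <=
    q j * (ln Z - ln s) + ((if S j then s * expR (b j) / Z else 0) - q j).
  have [qj0|qj0] := eqVneq (q j) 0.
    rewrite qj0 phi_ent0 !mul0r !add0r subr0; case: ifP => // _.
    by rewrite divr_ge0 ?mulr_ge0 ?expR_ge0// ltW.
  have qj : 0 < q j by rewrite lt_neqAle eq_sym qj0 q0.
  rewrite /phi_ent (negbTE qj0) (qS _ qj).
  have tp : 0 < s * expR (b j) / Z / q j by rewrite !divr_gt0// mulr_gt0// expR_gt0.
  have := expR_ge1Dx (ln (s * expR (b j) / Z / q j)).
  rewrite lnK ?posrE// ler_pdivlMr//.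
  rewrite !ln_div ?posrE ?mulr_gt0 ?divr_gt0 ?invr_gt0 ?expR_gt0 ?mulr_gt0 ?expR_gt0//.
  rewrite lnM ?posrE ?expR_gt0// expRK; set t := s * _ / Z; lra.
apply: (le_trans (ler_sum _ (fun j _ => term j))).
rewrite big_split/= sumrB -mulr_suml -/s -big_mkcond/= -mulr_suml -mulr_sumr -/Z.
by rewrite mulfK ?gt_eqF// /phi_ent gt_eqF//; lra.
Qed.

End entropy.

(** * Finite measurable partitions *)

Section finite_partition.
Context d (Y : measurableType d) (R : realType) (mu : probability Y R).

Definition fpart {J : finType} (A : J -> set Y) :=
  [/\ forall j, measurable (A j),
      forall i j, i != j -> A i `&` A j = set0 &
      forall x, exists j, A j x].

Definition pr (A : set Y) : R := fine (mu A).

Lemma pr_ge0 A : 0 <= pr A.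
Proof. by rewrite fine_ge0. Qed.

Lemma pr_mu A : measurable A -> (pr A)%:E = mu A.
Proof. by move=> mA; rewrite fineK// fin_num_measure. Qed.

Lemma pr0 : pr set0 = 0.
Proof. by rewrite /pr measure0. Qed.

Lemma prT : pr setT = 1.
Proof. by rewrite /pr probability_setT. Qed.

Lemma le_pr A B : measurable A -> measurable B -> A `<=` B -> pr A <= pr B.
Proof.
move=> mA mB AB; rewrite fine_le ?fin_num_measure//.
by apply: le_measure; rewrite ?inE.
Qed.

Lemma pr_fin_bigcup {J : finType} (A : J -> set Y) (S : pred J) :
  (forall j, measurable (A j)) ->
  (forall i j, i != j -> A i `&` A j = set0) ->
  pr (\bigcup_(j in [set j | S j]) A j) = \sum_(j | S j) pr (A j).
Proof.
move=> mA dA; rewrite /pr measure_fin_bigcup//; [|exact: finite_finset|by apply/trivIsetP => i j _ _; exact: dA].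
transitivity (fine (\sum_(j | S j) mu (A j))%E); last first.
  by rewrite sum_fine// => i _; exact: fin_num_measure.
by congr fine; rewrite (bigfs _ (index_enum_uniq J))// => i _; rewrite mem_index_enum.
Qed.

Lemma fpart_sum {J : finType} (A : J -> set Y) B : fpart A -> measurable B ->
  pr B = \sum_j pr (A j `&` B).
Proof.
move=> [mA dA cA] mB; rewrite -(@pr_fin_bigcup _ (fun j => A j `&` B) xpredT).
- congr pr; apply/seteqP; split=> [x Bx|x [j _ []]//].
  by have [j Aj] := cA x; exists j.
- by move=> j; exact: measurableI.
- by move=> i j ij; rewrite setIACA dA// set0I.
Qed.

End finite_partition.

(** * Cylinders, words and the entropy of iterated joins *)

Section cylinders.
Context d (Y : measurableType d) (R : realType) (mu : probability Y R).
Variable T : Y -> Y.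
Hypothesis mT : measurable_fun setT T.
Hypothesis muT : forall A, measurable A -> mu (T @^-1` A) = mu A.

Lemma measurable_iter_preimage n A : measurable A -> measurable (iter n T @^-1` A).
Proof.
move=> mA; elim: n => [//|n IH].
have -> : iter n.+1 T @^-1` A = T @^-1` (iter n T @^-1` A).
  by apply/seteqP; split=> x /=; rewrite -iterSr.
by rewrite -[X in measurable X]setTI; exact: mT.
Qed.

Lemma pr_iter_preimage n A : measurable A -> pr mu (iter n T @^-1` A) = pr mu A.
Proof.
move=> mA; elim: n => [//|n IH].
have -> : iter n.+1 T @^-1` A = T @^-1` (iter n T @^-1` A).
  by apply/seteqP; split=> x /=; rewrite -iterSr.
by rewrite /pr muT//; exact: measurable_iter_preimage.
Qed.

Lemma fpart_iter_preimage n {J : finType} (A : J -> set Y) :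
  fpart A -> fpart (fun j => iter n T @^-1` A j).
Proof.
move=> [mA dA cA]; split=> [j|i j ij|x]; first exact: measurable_iter_preimage.
  by rewrite -preimage_setI dA// preimage_set0.
exact: cA.
Qed.

Definition cyl {I : finType} (P : I -> set Y) n (u : {ffun 'I_n -> I}) : set Y :=
  \bigcap_(i in [set: 'I_n]) (iter i T @^-1` P (u i)).

(** For the index type ['I_k] this is [join_entropy] up to conversion. *)
Definition entropy {I : finType} (P : I -> set Y) n : R :=
  \sum_(u : {ffun 'I_n -> I}) phi_ent (pr mu (cyl P u)).

Lemma fpart_cyl {I : finType} (P : I -> set Y) n : fpart P -> fpart (@cyl I P n).
Proof.
move=> [mP dP cP]; split=> [u|u v uv|x].
- apply: fin_bigcap_measurable => [|i _]; first exact: finite_finset.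
  exact: measurable_iter_preimage.
- have [i uvi] : exists i, u i != v i.
    by apply/existsP; rewrite -negb_forall; apply: contra uv => /eqfunP/ffunP ->.
  apply/seteqP; split=> // x [ux vx].
  have : (P (u i) `&` P (v i)) (iter i T x) by split; [exact: ux|exact: vx].
  by rewrite dP.
- have [g gP] := choice (fun i : 'I_n => cP (iter i T x)).
  by exists [ffun i => g i] => i _ /=; rewrite ffunE.
Qed.

Definition catw {I : finType} n m (u : {ffun 'I_n -> I}) (v : {ffun 'I_m -> I}) :
    {ffun 'I_(n + m) -> I} :=
  [ffun i : 'I_(n + m) => match fintype.split i with inl a => u a | inr c => v c end].

Lemma cyl_catw {I : finType} (P : I -> set Y) n m (u : {ffun 'I_n -> I})
    (v : {ffun 'I_m -> I}) :
  cyl P (catw u v) = cyl P u `&` iter n T @^-1` cyl P v.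
Proof.
apply/seteqP; split=> [x ux|x [ux vx]].
  split=> i _ /=.
    have := ux (lshift m i) Logic.I; rewrite /= ffunE.
    by rewrite -[lshift m i]/(unsplit (inl i)) unsplitK.
  have := ux (rshift n i) Logic.I; rewrite /= ffunE.
  by rewrite -[rshift n i]/(unsplit (inr i)) unsplitK/= -iterD addnC.
move=> i _; rewrite /= ffunE; case: splitP => j ij.
  by rewrite ij; exact: ux.
by rewrite ij addnC iterD; exact: vx.
Qed.

Lemma sum_catw {I : finType} n m (F : {ffun 'I_(n + m) -> I} -> R) :
  \sum_w F w = \sum_(v : {ffun 'I_m -> I}) \sum_(u : {ffun 'I_n -> I}) F (catw u v).
Proof.
rewrite exchange_big pair_big/=.
rewrite (reindex (fun p : {ffun 'I_n -> I} * {ffun 'I_m -> I} => catw p.1 p.2))//.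
exists (fun w : {ffun 'I_(n + m) -> I} => ([ffun i => w (lshift m i)], [ffun i => w (rshift n i)])) => [[u v] _|w _].
  congr pair; apply/ffunP => i; rewrite !ffunE.
    by rewrite -[lshift m i]/(unsplit (inl i)) unsplitK.
  by rewrite -[rshift n i]/(unsplit (inr i)) unsplitK.
apply/ffunP => i; rewrite !ffunE/= -[in RHS](splitK i).
by case: (fintype.split i) => j; rewrite ffunE.
Qed.

Lemma entropy_ge0 {I : finType} (P : I -> set Y) n : fpart P -> 0 <= entropy P n.
Proof.
move=> fP; apply: sumr_ge0 => u _; rewrite /phi_ent; case: ifP => // /negbT u0.
rewrite oppr_ge0 mulr_ge0_le0 ?pr_ge0//; apply: ln_le0.
have [mC _ _] := fpart_cyl n fP.
by rewrite -(prT mu); apply: le_pr => //; exact: mC.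
Qed.

(** A [P]-cylinder is the disjoint union of the [P']-cylinders whose names [g] maps to its name, and
    splitting a mass into pieces can only increase the sum of [phi_ent]. *)
Lemma entropy_refine {I I' : finType} (P : I -> set Y) (P' : I' -> set Y)
    (g : I' -> I) n : fpart P -> fpart P' -> (forall j, P' j `<=` P (g j)) ->
  entropy P n <= entropy P' n.
Proof.
move=> fP fP' sub.
have fC := fpart_cyl n fP; have fC' := fpart_cyl n fP'.
have [mC dC _] := fC; have [mC' _ _] := fC'.
pose G (v : {ffun 'I_n -> I'}) : {ffun 'I_n -> I} := [ffun i => g (v i)].
have subC v : cyl P' v `<=` cyl P (G v).
  by move=> x vx i _ /=; rewrite ffunE; apply: sub; exact: vx.
have prC u : pr mu (cyl P u) = \sum_v (if G v == u then pr mu (cyl P' v) else 0).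
  rewrite (fpart_sum mu fC' (mC u)); apply: eq_bigr => v _.
  case: eqVneq => [<-|Gvu]; first by rewrite (setIidl (subC v)).
  suff -> : cyl P' v `&` cyl P u = set0 by rewrite pr0.
  apply/seteqP; split=> // x [/subC vx ux].
  by rewrite -(dC _ _ Gvu); split.
rewrite /entropy; under eq_bigr do rewrite prC.
apply: (@le_trans _ _ (\sum_u \sum_v phi_ent (if G v == u then pr mu (cyl P' v) else 0))).
  apply: ler_sum => u _; apply: phi_ent_sum_le => v.
  by case: ifP => // _; exact: pr_ge0.
rewrite exchange_big/=; apply: ler_sum => v _.
rewrite (bigD1 (G v))//= eqxx big1 ?addr0// => u /negbTE uG.
by rewrite eq_sym uG phi_ent0.
Qed.

Section weights.
Context {I : finType} (P : I -> set Y) (b : I -> R).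
Hypothesis fP : fpart P.

Definition bw n (u : {ffun 'I_n -> I}) : R := \sum_i b (u i).

(** The quantity Z_{n,m} of the overview, as a function of the future [v]. Compatibility asks for a
    common point rather than positive mass, so that compactness can act on it later. *)
Definition Zw n m (v : {ffun 'I_m -> I}) : R :=
  \sum_(u : {ffun 'I_n -> I} | `[< cyl P u `&` iter n T @^-1` cyl P v !=set0 >])
    expR (bw u).

(** By invariance each of the [n] coordinates contributes the same mean. *)
Lemma sum_pr_bw n : \sum_(u : {ffun 'I_n -> I}) pr mu (cyl P u) * bw u =
  n%:R * \sum_j pr mu (P j) * b j.
Proof.
have [mP dP _] := fP.
have [mC _ _] := fpart_cyl n fP.
under eq_bigr do rewrite mulr_sumr.
rewrite exchange_big/= -[n in n%:R]card_ord -sumr_const mulr_suml.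
apply: eq_bigr => i _; rewrite mul1r.
have fPi := fpart_iter_preimage i fP.
transitivity (\sum_(u : {ffun 'I_n -> I}) \sum_j
    pr mu (cyl P u `&` (iter i T @^-1` P j)) * b j).
  apply: eq_bigr => u _.
  rewrite (bigD1 (u i))//= setIidl => [|x ux]; last exact: (ux i).
  rewrite big1 ?addr0// => j ju.
  suff -> : cyl P u `&` (iter i T @^-1` P j) = set0 by rewrite pr0 mul0r.
  apply/seteqP; split=> // x [/(_ i Logic.I)/= ux jx].
  have : (P j `&` P (u i)) (iter i T x) by split.
  by rewrite dP.
rewrite exchange_big/=; apply: eq_bigr => j _.
rewrite -mulr_suml -(@pr_iter_preimage i)//; congr (_ * _).
by rewrite -fpart_sum//; [exact: fpart_cyl|exact: measurable_iter_preimage].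
Qed.

(* The finite variational principle, applied inside each atom
   [T^-n cyl v] to the cylinders [cyl u] that meet it. *)
Lemma entropy_pressure_le n m :
  entropy P (n + m) + n%:R * \sum_j pr mu (P j) * b j <=
  entropy P m + \sum_(v : {ffun 'I_m -> I}) pr mu (cyl P v) * ln (Zw n v).
Proof.
have fCn := fpart_cyl n fP; have fCm := fpart_cyl m fP.
have [mCm _ _] := fCm.
have fTC := fpart_iter_preimage n fCm.
have [mTC _ _] := fTC; have [mCn _ _] := fCn.
pose q (v : {ffun 'I_m -> I}) (u : {ffun 'I_n -> I}) :=
  pr mu (cyl P u `&` iter n T @^-1` cyl P v).
have qv v : \sum_u q v u = pr mu (cyl P v).
  by rewrite -(@pr_iter_preimage n)// (fpart_sum mu fCn)//; exact: mTC.
rewrite -sum_pr_bw /entropy sum_catw.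
have -> : \sum_(u : {ffun 'I_n -> I}) pr mu (cyl P u) * bw u =
    \sum_v \sum_u q v u * bw u.
  rewrite exchange_big/=; apply: eq_bigr => u _.
  rewrite -mulr_suml (fpart_sum mu fTC (mCn u)); congr (_ * _).
  by apply: eq_bigr => v _; rewrite setIC.
rewrite -!big_split/=; apply: ler_sum => v _; rewrite -big_split/=.
rewrite -qv; under eq_bigr do rewrite cyl_catw.
apply: gibbs_variational => [u|u qu]; first exact: pr_ge0.
apply/asboolP/set0P/eqP => H; move: qu.
by rewrite /q H pr0 ltxx.
Qed.

End weights.
End cylinders.

(** * Points with many compatible pasts *)

(* Otherwise the increments over steps of length [n] would be eventually below
   [n a'], forcing [H] to grow at a rate at most [a' < a]; no subadditivity or
   convergence of [H m / m] is involved. *)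
Lemma increments_ge {R : realType} (H : nat -> R) (a a' : R) (n : nat) :
  a' < a -> (0 < n)%N ->
  (exists M, forall m, (M <= m)%N -> m%:R * a <= H m) ->
  forall M, exists2 m, (M <= m)%N & n%:R * a' <= H (n + m)%N - H m.
Proof.
move=> aa' n0 [M0 HM0] M; apply: contrapT => Hno.
pose K := maxn M M0.
have inc j : H (K + j * n)%N <= H K + j%:R * (n%:R * a').
  elim: j => [|j IH]; first by rewrite mul0n addn0 mul0r addr0.
  have : ~ (n%:R * a' <= H (n + (K + j * n))%N - H (K + j * n)%N).
    by move=> H'; apply: Hno; exists (K + j * n)%N => //; rewrite /K; lia.
  move=> /negP; rewrite -ltNge => /ltW.
  have -> : (n + (K + j * n) = K + j.+1 * n)%N by rewrite mulSn; lia.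
  rewrite -[j.+1]addn1 natrD mulrDl mul1r; lra.
have lower j : (K + j * n)%N%:R * a <= H (K + j * n)%N.
  by apply: HM0; rewrite /K; lia.
have bd j : j%:R <= (H K - K%:R * a) / (n%:R * (a - a')).
  rewrite ler_pdivlMr ?mulr_gt0 ?subr_gt0 ?ltr0n//.
  have := lower j; have := inc j; rewrite natrD natrM.
  move=> h1 h2; rewrite -subr_ge0; move: (le_trans h2 h1); rewrite -subr_ge0.
  by congr (0 <= _); ring.
have := bd (Num.bound ((H K - K%:R * a) / (n%:R * (a - a')))).
have := archi_boundP (le_trans (ler0n _ 0) (bd 0%N)); lra.
Qed.

Section limsup_pr.
Context d (Y : measurableType d) (R : realType) (mu : probability Y R).

Lemma pr_bigcap_ge (F : (set Y)^nat) (t : R) :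
  (forall i, measurable (F i)) -> nonincreasing_seq F ->
  (forall i, t <= pr mu (F i)) -> t <= pr mu (\bigcap_n F n).
Proof.
move=> mF dF tF; have mI : measurable (\bigcap_n F n) by exact: bigcap_measurable.
have cvgF : mu \o F @ \oo --> mu (\bigcap_n F n).
  apply: nonincreasing_cvg_mu => //.
  by rewrite ltey_eq fin_num_measure.
rewrite -lee_fin pr_mu// -(cvg_lim _ cvgF)//; apply: lime_ge.
  by apply/cvg_ex; eexists; exact: cvgF.
by apply: nearW => n /=; rewrite -pr_mu// lee_fin.
Qed.

(** Reverse Fatou for sets: the tail unions decrease and each contains some [F i]. *)
Lemma pr_lim_sup_set_ge (F : (set Y)^nat) (t : R) :
  (forall i, measurable (F i)) -> (forall i, t <= pr mu (F i)) ->
  t <= pr mu (lim_sup_set F).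
Proof.
move=> mF tF; apply: pr_bigcap_ge => [i|i j ij|i].
- exact: bigcup_measurable.
- by apply/subsetPset => x [k/= jk Fk]; exists k => //=; exact: leq_trans jk.
- apply: (le_trans (tF i)); apply: le_pr => //; first exact: bigcup_measurable.
  by move=> x Fx; exists i => /=.
Qed.

End limsup_pr.

Section typical_names.
Context d (Y : measurableType d) (R : realType) (mu : probability Y R).
Variable T : Y -> Y.
Hypothesis mT : measurable_fun setT T.
Hypothesis muT : forall A, measurable A -> mu (T @^-1` A) = mu A.
Context {I : finType} (P : I -> set Y) (b : I -> R).
Hypothesis fP : fpart P.

(** Without the compatibility condition the sum runs over all words and factors letter by letter. *)
Lemma Zw_le n m (v : {ffun 'I_m -> I}) :
  Zw T P b n v <= (\sum_j expR (b j)) ^+ n.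
Proof.
rewrite -[n in _ ^+ n]card_ord -prodr_const bigA_distr_bigA/=.
rewrite /Zw [leLHS]big_mkcond/=; apply: ler_sum => u _.
by rewrite /bw expR_sum; case: ifP => // _; apply: prodr_ge0 => i _; exact: expR_ge0.
Qed.

Lemma Zw_gt0 n m (v : {ffun 'I_m -> I}) :
  0 < pr mu (cyl T P v) -> 0 < Zw T P b n v.
Proof.
have [_ _ cC] := fpart_cyl mT n fP; have [mC _ _] := fpart_cyl mT m fP.
rewrite -(pr_iter_preimage mT muT n)// => pv.
have [x vx] : iter n T @^-1` cyl T P v !=set0.
  by apply/set0P/eqP => E; move: pv; rewrite E pr0 ltxx.
have [u ux] := cC x.
rewrite /Zw (bigD1 u)/=; last by apply/asboolP; exists x.
by rewrite ltr_wpDr ?expR_gt0//; apply: sumr_ge0 => w _; exact: expR_ge0.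
Qed.

Definition good n (c : R) m : set Y :=
  \bigcup_(v in [set v : {ffun 'I_m -> I} | expR (n%:R * c) <= Zw T P b n v]) cyl T P v.

Lemma measurable_good n c m : measurable (good n c m).
Proof.
have [mC _ _] := fpart_cyl mT m fP.
by apply: fin_bigcup_measurable => [|v _]; [exact: finite_finset|exact: mC].
Qed.

(** Forgetting the last letter of a future enlarges its cylinder, so every compatible past stays
    compatible. *)
Lemma nonincreasing_good n c : nonincreasing_seq (good n c).
Proof.
apply/nonincreasing_seqP => m; apply/subsetPset => x [v /= gv vx].
pose v' : {ffun 'I_m -> I} := [ffun i => v (widen_ord (leqnSn m) i)].
have vv' : cyl T P v `<=` cyl T P v'.
  by move=> y vy i _ /=; rewrite ffunE; exact: (vy (widen_ord (leqnSn m) i)).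
exists v'; last exact: vv'.
apply: (le_trans gv); rewrite /Zw.
rewrite [leLHS]big_mkcond [leRHS]big_mkcond/=; apply: ler_sum => u _.
case: asboolP => [[y [uy vy]]|_]; last by case: ifP => // _; exact: expR_ge0.
by case: asboolP => // -[]; exists y; split => //; exact: vv'.
Qed.

(** Reverse Markov inequality: for suitable futures [ln Zw] has mean at least [n%:R * c1] and is at
    most [n%:R * M], so it reaches [n%:R * c] on mass at least [(c1 - c) / (M - c)], a bound free of
    [n] and [m]. *)
Lemma pr_good_ge (a c : R) :
  (exists M, forall m, (M <= m)%N -> m%:R * a <= entropy mu T P m) ->
  c < a + \sum_j pr mu (P j) * b j ->
  exists2 t : R, 0 < t & forall n m, (0 < n)%N -> t <= pr mu (good n c m).
Proof.
set be := \sum_j _ => Ha ca.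
(* The midpoint of [c - be] and [a]: it gives both [a' < a], for [increments_ge], and [c < c1]. *)
pose a' := (a + (c - be)) / 2; pose c1 := a' + be.
have a'a : a' < a by rewrite /a'; lra.
have cc1 : c < c1 by rewrite /c1 /a'; lra.
pose M := Num.max (ln (\sum_j expR (b j))) c1.
have c1M : c1 <= M by rewrite /M le_max lexx orbT.
exists ((c1 - c) / (M - c)); first by rewrite divr_gt0; lra.
move=> n m n0.
(* Only some [m'] beyond [m] has a large entropy increment; monotonicity of [good] carries the bound
   back to [m]. *)
have [m' mm' Hm'] := increments_ge a'a n0 Ha m.
suff : (c1 - c) / (M - c) <= pr mu (good n c m').
  move=> /le_trans; apply; apply: le_pr; try exact: measurable_good.
  by apply/subsetPset; exact: nonincreasing_good.
have fC := fpart_cyl mT m' fP; have [mC dC cC] := fC.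
have prgood : pr mu (good n c m') =
    \sum_(v : {ffun 'I_m' -> I} | expR (n%:R * c) <= Zw T P b n v) pr mu (cyl T P v).
  exact: pr_fin_bigcup.
have sum1 : \sum_(v : {ffun 'I_m' -> I}) pr mu (cyl T P v) = 1.
  rewrite -(prT mu) (fpart_sum mu fC)//.
  by apply: eq_bigr => v _; rewrite setIT.
have := entropy_pressure_le mT muT b fP n m'; rewrite -/be => key.
have up : \sum_(v : {ffun 'I_m' -> I}) pr mu (cyl T P v) * ln (Zw T P b n v) <=
   \sum_(v : {ffun 'I_m' -> I}) (pr mu (cyl T P v) * (n%:R * c) +
     (if expR (n%:R * c) <= Zw T P b n v then pr mu (cyl T P v) else 0)
        * (n%:R * (M - c))).
  apply: ler_sum => v _.
  have [p0|p0] := eqVneq (pr mu (cyl T P v)) 0.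
    by rewrite p0 if_same !mul0r addr0.
  have pv : 0 < pr mu (cyl T P v) by rewrite lt_neqAle eq_sym p0 pr_ge0.
  have Zp := Zw_gt0 n pv.
  case: (leP (expR (n%:R * c)) (Zw T P b n v)) => [_|Zlt]; last first.
    rewrite mul0r addr0 ler_wpM2l ?pr_ge0// -[leRHS]expRK ler_ln ?posrE ?expR_gt0//.
    exact: ltW.
  rewrite -mulrDr -mulrDr ler_wpM2l ?pr_ge0//.
  have ->: c + (M - c) = M by ring.
  have Sp : 0 < \sum_j expR (b j).
    rewrite lt_neqAle eq_sym; apply/andP; split; last first.
      by apply: sumr_ge0 => i _; exact: expR_ge0.
    apply/eqP => S0; have := lt_le_trans Zp (Zw_le n v).
    by rewrite S0 expr0n gtn_eqF// ltxx.
  apply: (@le_trans _ _ (n%:R * ln (\sum_j expR (b j)))).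
    by rewrite mulr_natl -lnXn// ler_ln ?posrE ?exprn_gt0//; exact: Zw_le.
  by rewrite ler_wpM2l// /M le_max lexx.
move: up; rewrite big_split/= -!mulr_suml sum1 mul1r -big_mkcond/= -prgood => up.
rewrite ler_pdivrMr; last lra.
rewrite -(ler_pM2l (x := n%:R)) ?ltr0n//.
move: key Hm' up; rewrite /c1; set g := pr _ _; set E := entropy _ _ _ _.
set E' := entropy _ _ _ _; set Q := \sum_v _ => key Hm' up.
have h : n%:R * (a' + be) <= n%:R * c + g * (n%:R * (M - c)) by lra.
rewrite -subr_ge0 (_ : _ - _ = n%:R * c + g * (n%:R * (M - c)) - n%:R * (a' + be)).
  by rewrite subr_ge0.
by ring.
Qed.

(** Intersecting over [m] keeps the mass bound by monotonicity, and the limsup over [n] keeps it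
    because the bound is uniform in [n]. *)
Lemma typical_names (a c : R) :
  (exists M, forall m, (M <= m)%N -> m%:R * a <= entropy mu T P m) ->
  c < a + \sum_j pr mu (P j) * b j ->
  exists G, [/\ measurable G, 0 < pr mu G &
    forall x, G x -> forall N, exists n, (N <= n)%N /\
      forall m (v : {ffun 'I_m -> I}), cyl T P v x -> expR (n%:R * c) <= Zw T P b n v].
Proof.
move=> Ha ca; have [t t0 tgood] := pr_good_ge Ha ca.
(* The index is [n.+1] because the mass bound is for positive lengths. *)
pose F n := \bigcap_m good n.+1 c m.
have mF n : measurable (F n).
  by apply: bigcap_measurable => // m _; exact: measurable_good.
exists (lim_sup_set F); split.
- by apply: bigcap_measurable => // n _; exact: bigcup_measurable.
- apply: (lt_le_trans t0); apply: pr_lim_sup_set_ge => // n.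
  apply: pr_bigcap_ge => [m||m].
  + exact: measurable_good.
  + exact: nonincreasing_good.
  + exact: tgood.
- move=> x Gx N; have [n /= Nn Fn] := Gx N Logic.I.
  exists n.+1; split; first exact: leqW.
  move=> m v vx; have [v' /= gv' v'x] := Fn m Logic.I.
  have [_ dC _] := fpart_cyl mT m fP.
  have [->//|vv'] := eqVneq v v'.
  have : (cyl T P v `&` cyl T P v') x by split.
  by rewrite dC.
Qed.

End typical_names.

(** * Compact metric spaces and Borel measures *)

Lemma inv_boundS_lt {R : realType} (e : R) : 0 < e -> (Num.bound e^-1).+1%:R^-1 < e.
Proof.
move=> e0; rewrite invf_plt ?posrE//; apply: (@lt_trans _ _ (Num.bound e^-1)%:R).
  by apply: archi_boundP; rewrite invr_ge0 ltW.
by rewrite ltr_nat.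
Qed.

Section metric_facts.
Context {R : realType} {X : metricType R}.

Lemma nbhs_mdist (x : X) e : 0 < e -> nbhs x [set y | mdist x y < e].
Proof. by move=> e0; apply/nbhs_ballP; exists e => //=; rewrite ballEmdist. Qed.

Lemma mdist_continuous (z : X) : continuous (mdist z).
Proof.
move=> x; apply/cvgrPdist_lt => e e0; near=> y.
have xy : mdist x y < e by near: y; exact: nbhs_mdist.
have := metric_triangle z x y; have := metric_triangle z y x.
rewrite [mdist y x]metric_sym ltr_norml => h1 h2; apply/andP; split; lra.
Unshelve. all: by end_near. Qed.

Lemma closed_ball_mdist (z : X) r : closed [set x | mdist z x <= r].
Proof.
apply: (closed_comp (f := mdist z) (D := [set t | t <= r])); last exact: closed_le.
by move=> x _; exact: mdist_continuous.
Qed.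

Lemma closed_far_mdist (z : X) r : closed [set x | r <= mdist z x].
Proof.
apply: (closed_comp (f := mdist z) (D := [set t | r <= t])); last exact: closed_ge.
by move=> x _; exact: mdist_continuous.
Qed.

Lemma iter_continuous (T : X -> X) n : continuous T -> continuous (iter n T).
Proof.
move=> cT; elim: n => [|n IH] x; first exact: cvg_id.
by apply: (@continuous_comp _ _ _ (iter n T) T); [exact: IH|exact: cT].
Qed.

Lemma closed_iter_preimage (T : X -> X) n (C : set X) :
  continuous T -> closed C -> closed (iter n T @^-1` C).
Proof. by move=> cT; apply: closed_comp => x _; exact: iter_continuous. Qed.

(** Compactness enters through cluster points of sequences, written with distances so that no
    subsequence has to be extracted. *)
Definition seq_cluster (u : nat -> X) (x : X) :=
  forall e, 0 < e -> forall N, exists2 n, (N <= n)%N & mdist x (u n) < e.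

Lemma seq_cluster_closed u x (C : set X) N : seq_cluster u x -> closed C ->
  (forall n, (N <= n)%N -> C (u n)) -> C x.
Proof.
move=> ux cC uC; apply: cC => B /nbhs_ballP[e /= e0]; rewrite ballEmdist => eB.
by have [n Nn xn] := ux e e0 N; exists (u n); split; [exact: uC|exact: eB].
Qed.

Hypothesis cX : compact [set: X].

Lemma seq_cluster_exists (u : nat -> X) : exists x, seq_cluster u x.
Proof.
have [x [_ ux]] := cX (F := u @ \oo) _ filterT.
exists x => e e0 N.
have [y [/= xy Ny]] : [set y | mdist x y < e] `&` [set y | exists2 n, (N <= n)%N & y = u n] !=set0.
  rewrite setIC; apply: ux; last exact: nbhs_mdist.
  by exists N => // n /= Nn; exists n.
by case: Ny xy => n Nn -> xy; exists n.
Qed.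

(** Otherwise points could be chosen forever at distance more than [r] from all earlier ones, and
    such a sequence has no cluster point. *)
Lemma finite_net r : 0 < r -> exists s : seq X, forall x, exists2 z, z \in s & mdist z x <= r.
Proof.
move=> r0; apply: contrapT => Hno.
have far (s : seq X) : exists x, forall z, z \in s -> r < mdist z x.
  apply: contrapT => Hs; apply: Hno; exists s => x.
  apply: contrapT => Hx; apply: Hs; exists x => z zs.
  by rewrite ltNge; apply/negP => zx; apply: Hx; exists z.
have [g gP] := choice far.
pose l := fix l n := if n is n'.+1 then g (l n') :: l n' else [::].
pose u n := g (l n).
have ul m n : (m < n)%N -> u m \in l n.
  elim: n => // n IH; rewrite ltnS leq_eqVlt /= inE => /orP[/eqP ->|mn].
    by rewrite eqxx.
  by rewrite IH ?orbT.
have [x ux] := seq_cluster_exists u.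
have r20 : 0 < r / 2 by rewrite divr_gt0.
have [m _ xm] := ux _ r20 0%N; have [n mn xn] := ux _ r20 m.+1.
have := gP (l n) (u m) (ul _ _ mn); rewrite -/(u n).
have := metric_triangle (u m) x (u n); rewrite [mdist _ x]metric_sym; lra.
Qed.

Lemma uniform_continuous_compact (f : X -> R) e : continuous f -> 0 < e ->
  exists2 r, 0 < r & forall x y, mdist x y <= r -> `|f x - f y| <= e.
Proof.
move=> cf e0; apply: contrapT => Hno.
have bad (n : nat) : exists p : X * X, mdist p.1 p.2 <= n.+1%:R^-1 /\ e < `|f p.1 - f p.2|.
  apply: contrapT => Hn; apply: Hno; exists n.+1%:R^-1 => // x y xy.
  by rewrite leNgt; apply/negP => fxy; apply: Hn; exists (x, y).
have [p pP] := choice bad.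
have [x px] := seq_cluster_exists (fun n => (p n).1).
have e20 : 0 < e / 2 by rewrite divr_gt0.
move/cvgrPdist_lt : (cf x) => /(_ _ e20)/nbhs_ballP[d /= d0].
rewrite ballEmdist => dP.
have d20 : 0 < d / 2 by rewrite divr_gt0.
have [N N0 Nd] : exists2 N, (0 < N)%N & N%:R^-1 < d / 2.
  by exists (Num.bound (d / 2)^-1).+1 => //; exact: inv_boundS_lt.
have [n Nn xn] := px _ d20 N.
have [pn fpn] := pP n.
have pd : mdist (p n).1 (p n).2 < d / 2.
  apply: (le_lt_trans pn); apply: le_lt_trans Nd.
  by rewrite lef_pV2 ?posrE ?ltr0n// ler_nat; exact: leqW.
have h1 : `|f x - f (p n).1| < e / 2 by apply: dP => /=; lra.
have h2 : `|f x - f (p n).2| < e / 2.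
  by apply: dP => /=; have := metric_triangle x (p n).1 (p n).2; lra.
move: fpn; rewrite ltNge => /negP; apply.
have := ler_normB (f x - f (p n).2) (f x - f (p n).1).
rewrite (_ : f x - f (p n).2 - (f x - f (p n).1) = f (p n).1 - f (p n).2); last ring.
lra.
Qed.

(** Otherwise points of [C] and [D] at distances tending to zero would share a cluster point, lying
    in both sets. *)
Lemma separation_compact (C D : set X) : closed C -> closed D -> C `&` D = set0 ->
  exists2 r, 0 < r & forall x y, C x -> D y -> r < mdist x y.
Proof.
move=> clC clD CD; apply: contrapT => Hno.
have bad (n : nat) : exists p : X * X, mdist p.1 p.2 <= n.+1%:R^-1 /\ C p.1 /\ D p.2.
  apply: contrapT => Hn; apply: Hno; exists n.+1%:R^-1 => // x y Cx Dy.
  by rewrite ltNge; apply/negP => xy; apply: Hn; exists (x, y).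
have [p pP] := choice bad.
have [x px] := seq_cluster_exists (fun n => (p n).1).
have px2 : seq_cluster (fun n => (p n).2) x.
  move=> d d0 M.
  have d20 : 0 < d / 2 by rewrite divr_gt0.
  have [N N0 Nd] : exists2 N, (0 < N)%N & N%:R^-1 < d / 2.
    by exists (Num.bound (d / 2)^-1).+1 => //; exact: inv_boundS_lt.
  have [n Nn xn] := px _ d20 (maxn N M).
  exists n; first by move: Nn; rewrite geq_max => /andP[].
  have [pn _] := pP n.
  have pd : mdist (p n).1 (p n).2 < d / 2.
    apply: (le_lt_trans pn); apply: le_lt_trans Nd.
    rewrite lef_pV2 ?posrE ?ltr0n// ler_nat; apply: leqW.
    by move: Nn; rewrite geq_max => /andP[].
  by have := metric_triangle x (p n).1 (p n).2; lra.
have : (C `&` D) x.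
  split; [apply: (seq_cluster_closed (N := 0) px clC)|apply: (seq_cluster_closed (N := 0) px2 clD)].
    by move=> n _; have [_ []] := pP n.
  by move=> n _; have [_ []] := pP n.
by rewrite CD.
Qed.

Lemma bounded_compact (f : X -> R) : continuous f -> exists2 F : R, 0 <= F & forall x, `|f x| <= F.
Proof.
move=> cf; have [r r0 fr] := uniform_continuous_compact cf (@ltr01 R).
have [s sP] := finite_net r0.
exists (1 + \sum_(z <- s) `|f z|).
  by rewrite addr_ge0// sumr_ge0.
move=> x; have [z zs zx] := sP x.
have : `|f z| <= \sum_(z <- s) `|f z|.
  by rewrite (big_rem z)//= lerDl sumr_ge0.
have := fr _ _ zx; have := ler_normD (f x - f z) (f z).
rewrite subrK distrC; lra.
Qed.

End metric_facts.

Section integral_partition.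
Context d (Y : measurableType d) (R : realType) (mu : probability Y R).

Lemma bounded_integrable (f : Y -> R) (F : R) (A : set Y) : measurable A ->
  measurable_fun setT f -> (forall x, `|f x| <= F) -> mu.-integrable A (EFin \o f).
Proof.
move=> mA mf fF; apply: measurable_bounded_integrable => //.
- by rewrite ltey_eq fin_num_measure.
- exact: measurable_funTS.
- by exists F; split; [exact: num_real|move=> M FM x _ /=; exact: le_trans (fF x) (ltW FM)].
Qed.

Lemma integral_le_fpart {J : finType} (A : J -> set Y) (f : Y -> R) (F : R) (c : J -> R) :
  fpart A -> measurable_fun setT f -> (forall x, `|f x| <= F) ->
  (forall j x, A j x -> f x <= c j) ->
  (\int[mu]_x (f x)%:E <= (\sum_j c j * pr mu (A j))%:E)%E.
Proof.
move=> [mA dA cA] mf fF fc.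
have UA : [set: Y] = \big[setU/set0]_(j <- index_enum J) A j.
  apply/seteqP; split=> // x _; have [j Aj] := cA x.
  by rewrite -bigcup_seq; exists j => //=; exact: mem_index_enum.
rewrite UA integral_bigsetU_EFin ?index_enum_uniq//; first last.
- by rewrite -UA; exact/measurable_EFinP.
- by apply/trivIsetP => i j _ _; exact: dA.
rewrite -sumEFin; apply: lee_sum => j _.
rewrite EFinM pr_mu// -integral_cst//; apply: le_integral => //.
- exact: bounded_integrable fF.
- apply: (@bounded_integrable (cst (c j)) `|c j|) => //.
- by move=> x; rewrite inE => Ax /=; rewrite lee_fin; exact: fc.
Qed.

End integral_partition.

(** * Borel measurability and inner regularity *)

Section borel.
Context {R : realType} {X : metricType R} (x0 : X).
Local Notation BX := (borel_type X x0).

Lemma measurable_open (A : set X) : open A -> measurable (A : set BX).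
Proof. by move=> oA; apply: sub_sigma_algebra. Qed.

Lemma measurable_closed (A : set X) : closed A -> measurable (A : set BX).
Proof.
move=> cA; rewrite -(setCK (A : set BX)); apply: measurableC.
by apply: measurable_open; exact: closed_openC.
Qed.

Lemma continuous_measurable_self (T : X -> X) : continuous T ->
  measurable_fun setT (T : BX -> BX).
Proof.
move=> cT; apply: (@measurability _ _ BX BX setT T (@open X)) => //.
move=> _ [B oB <-]; rewrite setTI; apply: measurable_open.
by apply: open_comp => // x _; exact: cT.
Qed.

Lemma continuous_measurable_real (f : X -> R) : continuous f ->
  measurable_fun setT (f : BX -> R).
Proof.
move=> cf; apply: (measurability _ (RGenOpens.measurableE R)).
move=> _ [_ [a [b ->]] <-]; rewrite setTI; apply: measurable_open.
apply: open_comp => [x _|]; first exact: cf.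
exact: interval_open.
Qed.

Variable mu : probability BX R.

(** The sets squeezed between a closed and an open set with small difference form a sigma-algebra
    containing the open sets; the two-sided form makes the class stable under complement. *)
Lemma inner_regular (A : set BX) e : measurable A -> 0 < e ->
  exists K : set X, [/\ closed K, K `<=` A & pr mu ((A : set BX) `\` K) <= e].
Proof.
pose D (A : set BX) := forall e, 0 < e -> exists F U : set X,
  [/\ closed F, open U, F `<=` A, A `<=` U & pr mu ((U : set BX) `\` F) <= e].
have mUF (F U : set X) : closed F -> open U -> measurable ((U : set BX) `\` F).
  by move=> cF oU; apply: measurableD; [exact: measurable_open|exact: measurable_closed].
suff DA : <<s (@open X : set (set (pX x0))) >> `<=` D.
  move=> mA e0; have [F [U [cF oU FA AO leUF]]] := DA _ mA e e0.
  exists F; split => //; apply: le_trans leUF; apply: le_pr.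
  - by apply: measurableD => //; exact: measurable_closed.
  - exact: mUF.
  - by move=> x [Ax Fx]; split => //; exact: AO.
apply: smallest_sub; first split.
- move=> e' e0; exists set0, set0; split => //; [exact: closed0|exact: open0|].
  by rewrite setD0 pr0 ltW.
- move=> B DB e' /DB[F [U [cF oU FB BO leUF]]]; exists (~` U), (~` F); split.
  + exact: open_closedC.
  + exact: closed_openC.
  + by move=> x Ox; split => // /BO.
  + by move=> x [_ Bx] /FB.
  + by rewrite setDE setCK setIC -setDE.
(* Half of [e'] pays, through a geometric series, for the union of the open sets minus the union of
   all the closed ones; the other half pays for keeping only finitely many closed sets, whose union
   is closed. *)
- move=> B DB e' e0.
  have e20 n : 0 < e' / 2 / (2 ^ n.+1)%:R by rewrite !divr_gt0// ltr0n expn_gt0.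
  have DBn n : exists p : set X * set X,
      [/\ closed p.1, open p.2, p.1 `<=` B n, B n `<=` p.2 &
       pr mu ((p.2 : set BX) `\` p.1) <= e' / 2 / (2 ^ n.+1)%:R].
    by have [F [U H]] := DB n _ (e20 n); exists (F, U).
  have [p pP] := choice DBn.
  pose U := \bigcup_n (p n).2; pose F N := \bigcup_(n in `I_N) (p n).1.
  have cF N : closed (F N).
    rewrite /F; apply: closed_bigcup => //.
    by move=> n _; have [] := pP n.
  have oU : open U by apply: bigcup_open => n _; have [] := pP n.
  pose FF := \bigcup_n (p n).1.
  have mp1 n : measurable ((p n).1 : set BX) by apply: measurable_closed; have [] := pP n.
  have mp2 n : measurable ((p n).2 : set BX) by apply: measurable_open; have [] := pP n.
  have mFF : measurable (FF : set BX) by exact: bigcup_measurable.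
  have mU : measurable (U : set BX) by exact: measurable_open.
  have mF N : measurable (F N : set BX) by exact: measurable_closed.
  have UFF : pr mu ((U : set BX) `\` FF) <= e' / 2.
    rewrite -lee_fin pr_mu; last exact: measurableD.
    apply: (@le_trans _ _ (\sum_(0 <= n <oo) mu ((p n).2 `\` (p n).1))%E).
      apply: measure_sigma_subadditive => //.
      - by move=> n; exact: measurableD.
      - exact: measurableD.
      - move=> x [[n _ pnx] FFx]; exists n => //; split => // pn1; apply: FFx.
        by exists n.
    apply: le_trans (epsilon_trick0 xpredT _); last by rewrite divr_ge0// ltW.
    apply: lee_nneseries => n _ //=.
    by rewrite -pr_mu; [rewrite lee_fin; have [] := pP n|exact: measurableD].
  have [N FN] : exists N, pr mu ((FF : set BX) `\` F N) <= e' / 2.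
    apply: contrapT => Hno.
    have : e' / 2 <= pr mu (\bigcap_n (FF `\` F n)).
      apply: pr_bigcap_ge => [N|i j ij|N].
      - exact: measurableD.
      - apply/subsetPset; apply: setDS => x [n /= ni pn].
        by exists n => //=; exact: leq_trans ij.
      - by rewrite leNgt; apply/negP => /ltW H; apply: Hno; exists N.
    have -> : \bigcap_n (FF `\` F n) = set0 :> set BX.
      apply/seteqP; split => // x H; have [[n _ pn] _] := H 0%N Logic.I.
      by have [_] := H n.+1 Logic.I; apply; exists n => /=.
    by rewrite pr0; lra.
  exists (F N), U; split => //.
  + by move=> x [n _ pn]; exists n => //; have [_ _ h _ _] := pP n; exact: h.
  + by move=> x [n _ pn]; exists n => //; have [_ _ _ h _] := pP n; exact: h.
  + have -> : (U : set BX) `\` F N = (U `\` FF) `|` (FF `\` F N).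
      apply/seteqP; split=> [x [Ox Fx]|x [[Ox Fx]|[Fx FNx]]].
      * by have [Fx'|Fx'] := pselect (FF x); [right|left].
      * by split => // -[n _ pn]; apply: Fx; exists n.
      * split => //; have [n _ pn] := Fx; exists n => //.
        by have [_ _ h1 h2 _] := pP n; apply/h2/h1.
    rewrite -lee_fin pr_mu; last by apply: measurableU; exact: measurableD.
    apply: le_trans (measureU2 mu (measurableD mU mFF) (measurableD mFF (mF N))) _.
    have h1 : (mu (U `\` FF) <= (e' / 2)%:E)%E.
      by rewrite -pr_mu ?lee_fin//; exact: measurableD.
    have h2 : (mu (FF `\` F N) <= (e' / 2)%:E)%E.
      by rewrite -pr_mu ?lee_fin//; exact: measurableD.
    by apply: le_trans (leeD h1 h2) _; rewrite -EFinD lee_fin; lra.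
- move=> U /= oU e' e0.
  (* An open set is exhausted by the closed sets of points at distance at least [N.+1%:R^-1] from
     its complement. *)
  pose F (N : nat) := \bigcap_(y in ~` U) [set x : X | N.+1%:R^-1 <= mdist y x].
  have cF N : closed (F N) by apply: closed_bigI => y _; exact: closed_far_mdist.
  have mU : measurable (U : set BX) by exact: measurable_open.
  have mF N : measurable (F N : set BX) by exact: measurable_closed.
  have FO N : F N `<=` U.
    move=> x Fx; apply: contrapT => Ox; have := Fx x Ox.
    by rewrite /= mdistxx leNgt invr_gt0 ltr0n.
  have [N FN] : exists N, pr mu ((U : set BX) `\` F N) <= e'.
    apply: contrapT => Hno.
    have : e' <= pr mu (\bigcap_n (U `\` F n)).
      apply: pr_bigcap_ge => [N|i j ij|N].
      - exact: measurableD.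
      - apply/subsetPset; apply: setDS => x Fx y Uy /=.
        apply: le_trans (Fx y Uy); rewrite lef_pV2 ?posrE ?ltr0n// ler_nat.
        exact: ij.
      - by rewrite leNgt; apply/negP => /ltW H; apply: Hno; exists N.
    have -> : \bigcap_n (U `\` F n) = set0 :> set BX.
      apply/seteqP; split => // x H; have [Ux _] := H 0%N Logic.I.
      have /nbhs_ballP[r /= r0 rU] : nbhs x U by exact: open_nbhs_nbhs.
      have [_] := H (Num.bound r^-1) Logic.I; apply => y Uy /=.
      rewrite leNgt; apply/negP => yx; apply: Uy; apply: rU.
      rewrite ballEmdist/= metric_sym; apply: (lt_trans yx).
      exact: inv_boundS_lt.
    by rewrite pr0; lra.
  by exists (F N), U; split.
Qed.

End borel.

(** * From names to separated sets *)

Lemma sum_at_most_one {R : realType} {J : finType} (Q : pred J) :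
  (forall i j, Q i -> Q j -> i = j) -> \sum_(j | Q j) (1 : R) <= 1.
Proof.
move=> Q1; case: (pickP Q) => [j0 Qj0|Q0]; last by rewrite big_pred0.
rewrite (bigD1 j0)//= big_pred0 ?addr0// => j.
by apply/negP => /andP[Qj /eqP]; apply; exact: Q1.
Qed.

Section separated_sets.
Context {R : realType} {X : metricType R}.
Variable T : X -> X.

Lemma bowen_dist_le n (x y : X) r : 0 <= r ->
  (forall i, (i < n)%N -> mdist (iter i T x) (iter i T y) <= r) ->
  bowen_dist T n x y <= r.
Proof.
move=> r0 H; rewrite /bowen_dist; elim/big_ind: _ => // [a b ar br|i _].
  by rewrite ge_max ar.
exact: H.
Qed.

Lemma le_bowen_dist n (x y : X) i : (i < n)%N ->
  mdist (iter i T x) (iter i T y) <= bowen_dist T n x y.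
Proof. by move=> ni; exact: (le_bigmax _ _ (Ordinal ni)). Qed.

Lemma bowen_distC n (x y : X) : bowen_dist T n x y = bowen_dist T n y x.
Proof. by apply: eq_bigr => i _; rewrite metric_sym. Qed.

(** Greedy choice: a point is kept only when no kept point is [delta]-close. The result also spans
    [s], so that each word can later be charged to a point of [E]. *)
Lemma maximal_separated n delta (s : seq X) : 0 <= delta ->
  exists E : seq X, [/\ uniq E, {subset E <= s},
    (forall x y, x \in E -> y \in E -> x != y -> delta < bowen_dist T n x y) &
    forall y, y \in s -> exists2 z, z \in E & bowen_dist T n y z <= delta].
Proof.
move=> d0; elim: s => [|a s [E [uE Es sepE covE]]]; first by exists [::].
have [[z zE az]|Hno] := pselect (exists2 z, z \in E & bowen_dist T n a z <= delta).
  exists E; split=> // [x xE|y]; first by rewrite inE Es ?orbT.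
  by rewrite inE => /orP[/eqP ->|/covE//]; exists z.
have far z : z \in E -> delta < bowen_dist T n a z.
  by move=> zE; rewrite ltNge; apply/negP => az; apply: Hno; exists z.
have aa : bowen_dist T n a a <= delta.
  by apply: bowen_dist_le => // i _; rewrite mdistxx.
exists (a :: E); split.
- by rewrite /= uE andbT; apply/negP => /far; rewrite ltNge aa.
- by move=> x; rewrite !inE => /orP[->//|/Es ->]; rewrite orbT.
- move=> x y; rewrite !inE => /orP[/eqP ->|xE] /orP[/eqP ->|yE].
  + by rewrite eqxx.
  + by move=> _; exact: far.
  + by move=> _; rewrite bowen_distC; exact: far.
  + exact: sepE.
- move=> y; rewrite inE => /orP[/eqP ->|/covE[z zE yz]].
    by exists a; rewrite ?mem_head.
  by exists z; rewrite // inE zE orbT.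
Qed.

End separated_sets.

(** * Extraction of separated sets from compatible names *)

Section extraction.
Context {R : realType} {X : metricType R} (x0 : X).
Local Notation BX := (borel_type X x0).
Variables (T : X -> X) (f : X -> R).
Context {I : finType}.
Variables (P : I -> set BX) (C : I -> set X) (c : I -> R) (small : pred I).
Variables (eps delta eta K : R).
Hypotheses (cX : compact [set: X]) (cT : continuous T).
Hypothesis delta0 : 0 <= delta.
Hypothesis coverP : forall x, exists j, P j x.
Hypothesis PC : forall j, P j `<=` C j.
Hypothesis clC : forall j, closed (C j).
Hypothesis diamC : forall j x y, C j x -> C j y -> mdist x y <= eps.
Hypothesis sepC : forall i j x y, ~~ small i -> ~~ small j -> i != j ->
  C i x -> C j y -> 2 * delta < mdist x y.
Hypothesis fC : forall j x, C j x -> c j <= f x + eta.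
Hypothesis fdelta : forall x y, mdist x y <= delta -> `|f x - f y| <= eta.
Hypothesis Keta : #|I|%:R * expR (- K) <= eta.

(** No separation is assumed for small letters; the penalty [K] makes up for it, since by [Keta] all
    of them together weigh at most [eta]. *)
Let b j := c j - (if small j then K else 0).

(* Along the orbit of [z], at most one non-small letter is compatible with
   [delta]-closeness, while each small letter costs [expR (- K)]. *)
Definition near_letter n (z : X) (i : 'I_n) (j : I) : bool :=
  ~~ small j && `[< exists2 p, C j p & mdist p (iter i T z) <= delta >].

Definition letter_weight n (z : X) (i : 'I_n) (j : I) : R :=
  if small j then expR (- K) else (near_letter z i j)%:R.

Lemma letter_weight_ge0 n z (i : 'I_n) j : 0 <= letter_weight z i j.
Proof. by rewrite /letter_weight; case: ifP => _; rewrite ?expR_ge0. Qed.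

(** The sum factors over the positions, and each factor is at most [1 + #|I|%:R * expR (- K)], hence
    at most [expR eta]. *)
Lemma sum_letter_weight n z :
  \sum_(u : {ffun 'I_n -> I}) \prod_i letter_weight z i (u i) <= expR (n%:R * eta).
Proof.
rewrite -bigA_distr_bigA/= -[n in expR (n%:R * _)]card_ord -sumr_const mulr_suml expR_sum.
apply: ler_prod => i _; apply/andP; split.
  by apply: sumr_ge0 => j _; exact: letter_weight_ge0.
rewrite mul1r; apply: le_trans (expR_ge1Dx eta).
have unique_near j j' : near_letter z i j -> near_letter z i j' -> j = j'.
  move=> /andP[sj /asboolP[p jp pz]] /andP[sj' /asboolP[p' jp' pz']].
  apply/eqP/negPn/negP => jj'; have := sepC sj sj' jj' jp jp'.
  by have := metric_triangle p (iter i T z) p'; rewrite [mdist (iter _ _ _) _]metric_sym; lra.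
apply: (@le_trans _ _ (\sum_j (expR (- K) + (near_letter z i j)%:R))).
  apply: ler_sum => j _; rewrite /letter_weight; case: ifP => _.
    by rewrite lerDl.
  by rewrite lerDr expR_ge0.
rewrite big_split/= sumr_const -mulr_natl addrC lerD//.
apply: le_trans (sum_at_most_one (R := R) unique_near).
by rewrite [leRHS]big_mkcond/=; apply: ler_sum => j _; case: ifP => _.
Qed.

(** At each position one [eta] is lost in passing from [c] to [f] along the orbit of [y], and one in
    moving to the orbit of [z]. A letter that is not small is near [z], as witnessed by [y]. *)
Lemma word_weight_le n (u : {ffun 'I_n -> I}) (y z : X) :
  (forall i : 'I_n, C (u i) (iter i T y)) -> bowen_dist T n y z <= delta ->
  expR (bw b u) <=
  expR (2 * (n%:R * eta)) * expR (birk_sum T f n z) * \prod_i letter_weight z i (u i).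
Proof.
move=> Cy yz.
have -> : 2 * (n%:R * eta) = \sum_(i < n) (2 * eta).
  by rewrite sumr_const card_ord -mulr_natl; ring.
rewrite /bw /birk_sum !expR_sum -!big_split/=.
apply: ler_prod => i _; rewrite expR_ge0/= -expRD.
have yzi : mdist (iter i T y) (iter i T z) <= delta.
  by apply: le_trans yz; exact: le_bowen_dist.
have := fC (Cy i); have := fdelta yzi; rewrite ler_norml => /andP[h1 h2] h3.
rewrite /letter_weight /b; case: ifPn => si.
  by rewrite -expRD ler_expR; lra.
rewrite (_ : near_letter z i (u i)); first by rewrite mulr1 ler_expR; lra.
by rewrite /near_letter si; apply/asboolP; exists (iter i T y).
Qed.

(* Limit points of names are only known to follow the closed sets [C]. *)
Lemma shadowing_point n (u : {ffun 'I_n -> I}) (nm : nat -> I) :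
  (forall m, cyl (T : BX -> BX) P u `&`
     (iter n T : BX -> BX) @^-1` cyl (T : BX -> BX) P [ffun i : 'I_m => nm i] !=set0) ->
  exists y : X, (forall i : 'I_n, C (u i) (iter i T y)) /\
    (forall i, C (nm i) (iter i T (iter n T y))).
Proof.
move=> H; have [y yP] := choice H.
have [x yx] := seq_cluster_exists cX (y : nat -> X).
exists x; split=> [i|i].
  change ((iter i T @^-1` C (u i)) x).
  apply: (seq_cluster_closed (N := 0%N) yx (closed_iter_preimage (n := i) cT (@clC (u i)))).
  by move=> m _; have [yu _] := yP m; apply: PC; exact: yu.
rewrite -iterD; change ((iter (i + n) T @^-1` C (nm i)) x).
(* The letter [nm i] is prescribed only once [m] exceeds [i]. *)
apply: (seq_cluster_closed (N := i.+1) yx (closed_iter_preimage (n := i + n) cT (@clC (nm i)))).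
move=> m im; have [_ yv] := yP m; apply: PC; rewrite iterD.
by have := yv (Ordinal im) Logic.I; rewrite /= ffunE.
Qed.

(** Words compatible with the whole future of [x] have shadowing points. Each word is charged to a
    point of a maximal separated set [E] of these, close to its own shadowing point. Two factors
    [expR (n%:R * eta)] come from [word_weight_le], the third from [sum_letter_weight]. *)
Lemma separated_extraction (x : X) n t :
  (forall m (v : {ffun 'I_m -> I}), cyl (T : BX -> BX) P v x ->
     t <= Zw (T : BX -> BX) P b n v) ->
  exists2 E : seq X, Defs.separated T n delta (iter n T @^-1` stable_set T eps x) E &
    t <= expR (3 * (n%:R * eta)) * \sum_(z <- E) expR (birk_sum T f n z).
Proof.
move=> tZ.
have [nm nmP] := choice (fun i => coverP (iter i T x)).
pose v m : {ffun 'I_m -> I} := [ffun i : 'I_m => nm i].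
have vx m : cyl (T : BX -> BX) P (v m) x by move=> i _; rewrite /= ffunE; exact: nmP.
pose S m (u : {ffun 'I_n -> I}) := cyl (T : BX -> BX) P u `&`
  (iter n T : BX -> BX) @^-1` cyl (T : BX -> BX) P (v m) !=set0.
have Sdec m m' u : (m <= m')%N -> S m' u -> S m u.
  move=> mm' [y [yu yv]]; exists y; split => // i _.
  by have := yv (widen_ord mm' i) Logic.I; rewrite /= !ffunE.
pose Sall u := forall m, S m u.
(* There are finitely many words, so a single length [M] excludes every word that any length
   excludes. *)
have [M MS] : exists M, forall u, S M u -> Sall u.
  have /choice[g gP] u : exists m, S m u -> Sall u.
    have [?|/existsNP[m Hm]] := pselect (Sall u); first by exists 0%N.
    by exists m.
  exists (\max_u g u)%N => u Su; apply: gP; apply: Sdec Su.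
  exact: leq_bigmax.
have /choice[y yP] u : exists y : X, Sall u ->
    (forall i : 'I_n, C (u i) (iter i T y)) /\ (forall i, C (nm i) (iter i T (iter n T y))).
  have [Su|Su] := pselect (Sall u); last by exists x.
  by have [y yP] := shadowing_point Su; exists y.
pose s := [seq y u | u <- enum {ffun 'I_n -> I} & `[< Sall u >]].
have [E [uE Es sepE covE]] := maximal_separated T n s delta0.
exists E.
  split => //; split=> // z /Es /mapP[u]; rewrite mem_filter => /andP[/asboolP Su _] ->.
  (* From time [n] on, the shadowing point visits the same sets [C] as [x], and these have diameter
     at most [eps]. *)
  move=> i /=; have [_ yi] := yP u Su.
  by apply: (diamC (PC (nmP i))); exact: yi.
apply: (le_trans (tZ M (v M) (vx M))).
apply: (@le_trans _ _ (\sum_(u : {ffun 'I_n -> I}) \sum_(z <- E)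
    expR (2 * (n%:R * eta)) * expR (birk_sum T f n z) * \prod_i letter_weight z i (u i))).
  rewrite /Zw big_mkcond/=; apply: ler_sum => u _.
  have nneg z : 0 <= expR (2 * (n%:R * eta)) * expR (birk_sum T f n z) *
      \prod_i letter_weight z i (u i).
    by rewrite !mulr_ge0 ?expR_ge0// prodr_ge0// => i _; exact: letter_weight_ge0.
  case: asboolP => [/MS Su|_]; last by apply: sumr_ge0.
  have [yu _] := yP u Su.
  have [z zE yz] : exists2 z, z \in E & bowen_dist T n (y u) z <= delta.
    by apply: covE; apply: map_f; rewrite mem_filter mem_enum andbT; apply/asboolP.
  rewrite (big_rem z)//=; apply: ler_wpDr; first by apply: sumr_ge0.
  exact: word_weight_le yu yz.
rewrite exchange_big/= mulr_sumr; apply: ler_sum => z _.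
rewrite -mulr_sumr mulrAC ler_wpM2r ?expR_ge0//.
have -> : 3 * (n%:R * eta) = 2 * (n%:R * eta) + n%:R * eta by ring.
by rewrite expRD ler_wpM2l ?expR_ge0//; exact: sum_letter_weight.
Qed.

End extraction.

(** * Exponential growth on a set of positive measure *)

Section growth.
Context {R : realType} {X : metricType R} (x0 : X).
Local Notation BX := (borel_type X x0).
Variable mu : probability BX R.
Variable T : X -> X.

Lemma fpart_measurable_partition k (P : 'I_k -> set BX) :
  measurable_partition P -> fpart P.
Proof.
move=> [mP [dP cP]]; split=> // x.
have [i _ Pi] : (\bigcup_(i in [set: 'I_k]) P i) x by rewrite cP.
by exists i.
Qed.

(** Convergent quotients eventually exceed [a]; in the divergent case [a] is negative while
    entropies are nonnegative. *)
Lemma entropy_eventually_ge k (P : 'I_k -> set BX) a :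
  continuous T -> measurable_partition P -> a < partition_entropy mu T P ->
  exists M, forall m, (M <= m)%N -> m%:R * a <= entropy mu T P m.
Proof.
move=> cT /fpart_measurable_partition fP ah.
have H0 m : 0 <= entropy mu (T : BX -> BX) P m.
  by apply: entropy_ge0 => //; exact: continuous_measurable_self.
have [cvgH|dvgH] := pselect (cvg (join_entropy mu T P n / n%:R @[n --> \oo])).
  have [M _ MH] := cvgr_gt _ cvgH _ ah.
  exists M => -[|m] Mm; first by rewrite mul0r.
  by have /ltW := MH _ Mm; rewrite /= ler_pdivlMr// mulrC.
(* [lim] of a divergent real sequence is the junk value [0]. *)
exists 0%N => m _; apply: le_trans (H0 m); apply: mulr_ge0_le0 => //.
move: ah; rewrite /partition_entropy dvgP// => /ltW.
exact.
Qed.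

Lemma finite_lower_bound {J : finType} (r : J -> R) : (forall j, 0 < r j) ->
  exists2 d, 0 < d & forall j, d <= r j.
Proof.
move=> r0; exists (\big[Num.min/1]_j r j); last by move=> j; exact: bigmin_le_cond.
by elim/big_ind: _ => // a b a0 b0; rewrite lt_min a0.
Qed.

Lemma ball_partition (r : R) (s : seq X) : (forall x, exists2 z, z \in s & mdist z x <= r) ->
  exists Q : 'I_(size s) -> set BX, fpart Q /\
    forall i x, Q i x -> mdist (nth x0 s i) x <= r.
Proof.
move=> cov; pose B (i : nat) : set BX := [set x : X | mdist (nth x0 s i) x <= r].
have mB i : measurable (B i) by apply: measurable_closed; exact: closed_ball_mdist.
exists (fun i : 'I_(size s) => B i `\` \bigcup_(j in [set j : nat | (j < i)%N]) B j).
split; last by move=> i x [].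
split.
- by move=> i; apply: measurableD => //; exact: bigcup_measurable.
- move=> i j ij; apply/seteqP; split=> // x [[Bi ni] [Bj nj]].
  by have [lt|lt|/val_inj eq] := ltngtP i j;
    [apply: nj; exists i|apply: ni; exists j|rewrite eq eqxx in ij].
- move=> x.
  have ex : exists i, (i < size s)%N && (mdist (nth x0 s i) x <= r).
    have [z zs zx] := cov x; exists (index z s).
    by rewrite index_mem zs nth_index.
  have [i /andP[si ix] imin] := find_ex_minn ex.
  exists (Ordinal si); split => // -[j /= ji jx].
  have := imin j; rewrite (ltn_trans ji si) => /(_ jx).
  by rewrite leqNgt ji.
Qed.

(** The choices come in the order [eta], [r], [K], [eta'], [delta]: the penalty depends only on
    [eta] and the number of letters, so it is known before the compact sets are selected to fit
    it. *)
Lemma positive_measure_growth (f : X -> R) k (P0 : 'I_k -> set BX) (eps c : R) :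
  compact [set: X] -> continuous T -> continuous f -> invariant_measure mu T ->
  measurable_partition P0 -> 0 < eps ->
  (c%:E < (partition_entropy mu T P0)%:E + \int[mu]_x (f x)%:E)%E ->
  exists delta (G : set BX), [/\ 0 < delta, measurable G, 0 < pr mu G &
    forall x, G x -> forall N, exists n, (N <= n)%N /\
    exists2 E : seq X, Defs.separated T n delta (iter n T @^-1` stable_set T eps x) E &
      expR (n%:R * c) <= \sum_(z <- E) expR (birk_sum T f n z)].
Proof.
move=> cX cT cf muT mP0 eps0.
have fP0 := fpart_measurable_partition mP0.
have mT := continuous_measurable_self (x0 := x0) cT.
have mf := continuous_measurable_real (x0 := x0) cf.
have [F F0 fF] := bounded_compact cX cf.
have intf : mu.-integrable setT (EFin \o (f : BX -> R)) by exact: (@bounded_integrable _ _ _ mu f F _ measurableT mf fF).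
have := integrable_fin_num measurableT intf.
set phi := (\int[mu]_x (f x)%:E)%E => phifin.
rewrite -(fineK phifin) -EFinD lte_fin; set h := partition_entropy _ _ _ => chphi.
(* Six [eta] are spent: one on the entropy, two on the mean of [b], three in
   [separated_extraction]. *)
pose eta := (h + fine phi - c) / 10.
have eta0 : 0 < eta by rewrite /eta; lra.
have [r0 r00 fr0] := uniform_continuous_compact cX cf eta0.
pose r := Num.min r0 (eps / 2).
have r_gt0 : 0 < r by rewrite lt_min r00 divr_gt0.
have rr0 : r <= r0 by rewrite ge_min lexx.
have reps : r <= eps / 2 by rewrite ge_min lexx orbT.
have [s sP] := finite_net cX r_gt0.
have [Q [fQ Qball]] := ball_partition sP.
pose A : finType := ('I_k * 'I_(size s))%type.
pose I : finType := (A * bool)%type.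
pose K := #|I|%:R / eta.
have K0 : 0 <= K by rewrite divr_ge0// ltW.
have Keta : #|I|%:R * expR (- K) <= eta.
  rewrite expRN ler_pdivrMr ?expR_gt0// mulrC -ler_pdivrMr//.
  by apply: le_trans (expR_ge1Dx K); rewrite lerDr.
pose Pa (a : A) : set BX := P0 a.1 `&` Q a.2.
have mPa a : measurable (Pa a).
  by have [m0 _ _] := fP0; have [mQ _ _] := fQ; exact: measurableI.
have dPa a a' : a != a' -> Pa a `&` Pa a' = set0.
  move=> aa'; apply/seteqP; split=> // x [[x1 x2] [x1' x2']].
  have [_ d0 _] := fP0; have [_ dQ _] := fQ.
  have [e1|/d0 e1] := eqVneq a.1 a'.1; last first.
    by have : (P0 a.1 `&` P0 a'.1) x by []; rewrite e1.
  have [e2|/dQ e2] := eqVneq a.2 a'.2; last first.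
    by have : (Q a.2 `&` Q a'.2) x by []; rewrite e2.
  by move: aa'; rewrite (surjective_pairing a) (surjective_pairing a') e1 e2 eqxx.
(* All remainders together then have mass at most [eta / (K + 1)], so their penalty stays below
   [eta]; the added ones keep the denominators positive. *)
pose eta' := eta / (K + 1) / (#|A|%:R + 1).
have K1 : 0 < K + 1 by rewrite ltr_wpDl.
have A1 : 0 < #|A|%:R + 1 :> R by rewrite ltr_wpDl.
have eta'0 : 0 < eta' by apply: divr_gt0 => //; exact: divr_gt0.
have [Kc KcP] := choice (fun a => inner_regular mu (mPa a) eta'0).
have mKc a : measurable (Kc a : set BX).
  by apply: measurable_closed; have [] := KcP a.
(* Each [Pa a] is split into a compact part and a small remainder (flag
   [true]), on which the weight [b] below is lowered by [K]. *)
pose P (j : I) : set BX := if j.2 then Pa j.1 `\` Kc j.1 else Kc j.1.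
have PPa j : P j `<=` Pa j.1.
  rewrite /P; case: ifP => _; first by move=> x [].
  by have [] := KcP j.1.
have fP : fpart P.
  split.
  - by move=> [a []]; rewrite /P/=; [exact: measurableD|exact: mKc].
  - move=> i j ij; apply/seteqP; split=> // x [xi xj].
    have [e1|/dPa e1] := eqVneq i.1 j.1; last first.
      have : (Pa i.1 `&` Pa j.1) x by split; exact: PPa.
      by rewrite e1.
    move: ij xi xj e1; case: i => a b; case: j => a' b' /= + + + e1.
    by rewrite -e1 /P; case: b; case: b'; rewrite ?eqxx//= => _; [case|move=> ? []].
  - move=> x; have [_ _ c0] := fP0; have [_ _ cQ] := fQ.
    have [i ix] := c0 x; have [j jx] := cQ x.
    have [kx|kx] := pselect (Kc (i, j) x); first by exists ((i, j), false).
    by exists ((i, j), true); split.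
(* A remainder need not be closed, so the closed ball of the net containing it is used instead. *)
pose C (j : I) : set X :=
  if j.2 then [set x | mdist (nth x0 s j.1.2) x <= r] else Kc j.1.
have Cball j x : C j x -> mdist (nth x0 s j.1.2) x <= r.
  rewrite /C; case: ifP => // _ Kx; apply: Qball.
  by have [_ + _] := KcP j.1 => /(_ _ Kx) [].
pose ce (j : I) : R := f (nth x0 s j.1.2).
pose small (j : I) := j.2.
have PC j : P j `<=` C j.
  move=> x Px; have [_ Qx] := PPa _ _ Px; move: Px.
  by rewrite /P /C; case: ifP => // _ _; exact: Qball.
have clC j : closed (C j).
  by rewrite /C; case: ifP => _; [exact: closed_ball_mdist|have [] := KcP j.1].
have diamC j x y : C j x -> C j y -> mdist x y <= eps.
  move=> /Cball jx /Cball jy; have := metric_triangle x (nth x0 s j.1.2) y.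
  by rewrite [mdist x (nth _ _ _)]metric_sym; lra.
have fC j x : C j x -> `|ce j - f x| <= eta.
  by move=> /Cball jx; apply: fr0; exact: le_trans rr0.
have sepa (p : A * A) : exists d, 0 < d /\ (p.1 != p.2 -> forall x y,
    Kc p.1 x -> Kc p.2 y -> d < mdist x y).
  have [e|ne] := eqVneq p.1 p.2; first by exists 1.
  have [c1 s1 _] := KcP p.1; have [c2 s2 _] := KcP p.2.
  have [|d d0 dP] := separation_compact cX c1 c2.
    by apply/seteqP; split=> // x [/s1 x1 /s2 x2]; rewrite -(dPa _ _ ne).
  by exists d; split.
have [dsep dsepP] := choice sepa.
have [d d0 dmin] := finite_lower_bound (fun p => (dsepP p).1).
(* Half of [d] because [sepC] speaks of [2 * delta]; the bound [r0] controls the oscillation of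
   [f]. *)
pose delta := Num.min (d / 2) r0.
have delta0 : 0 < delta by rewrite lt_min r00 divr_gt0.
have deltar0 : delta <= r0 by rewrite ge_min lexx orbT.
have deltad : delta <= d / 2 by rewrite ge_min lexx.
have sepC i j x y : ~~ small i -> ~~ small j -> i != j ->
    C i x -> C j y -> 2 * delta < mdist x y.
  case: i => a b; case: j => a' b'; rewrite /small/= => /negbTE -> /negbTE ->.
  rewrite /C/= => ij ax ay.
  have aa' : a != a' by apply: contra_neq ij => ->.
  have := (dsepP (a, a')).2 aa' x y ax ay; have := dmin (a, a'); lra.
have fdelta x y : mdist x y <= delta -> `|f x - f y| <= eta.
  by move=> xy; apply: fr0; exact: le_trans deltar0.
pose b j := ce j - (if small j then K else 0).
have sumP1 : \sum_j pr mu (P j) = 1.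
  by rewrite -(prT mu) (fpart_sum mu fP)//; apply: eq_bigr => j _; rewrite setIT.
(* One [eta] is the oscillation of [f] on a ball of the net, the other the total penalty of the
   remainders. *)
have beta_ge : fine phi - 2 * eta <= \sum_j pr mu (P j) * b j.
  have h1 : fine phi <= \sum_j (ce j + eta) * pr mu (P j).
    rewrite -lee_fin fineK//.
    apply: (@integral_le_fpart _ _ _ mu I P f F (fun j => ce j + eta) fP mf fF).
    by move=> j x /PC/fC; rewrite ler_norml => /andP[]; lra.
  have h2 : K * \sum_(j | small j) pr mu (P j) <= eta.
    have -> : \sum_(j | small j) pr mu (P j) = \sum_a pr mu (Pa a `\` Kc a).
      rewrite (reindex (fun a : A => (a, true)))/=; first exact: eq_bigl.
      exists (fun j : I => j.1) => // -[a b']; rewrite unfold_in /small/=.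
      by move=> ->.
    apply: (@le_trans _ _ (K * (#|A|%:R * eta'))).
      rewrite ler_wpM2l//.
      have -> : #|A|%:R * eta' = \sum_(a : A) eta' by rewrite sumr_const mulr_natl.
      by apply: ler_sum => a _; have [] := KcP a.
    have -> : K * (#|A|%:R * eta') = (K / (K + 1)) * (#|A|%:R / (#|A|%:R + 1)) * eta.
      by rewrite /eta'; field; rewrite !gt_eqF.
    have frac_le1 (t : R) : 0 <= t -> 0 <= t / (t + 1) <= 1.
      by move=> t0; rewrite divr_ge0 ?addr_ge0//= ler_pdivrMr ?ltr_wpDl// mul1r lerDl.
    have /andP[p0 p1] := frac_le1 _ K0; have /andP[q0 q1] := frac_le1 _ (ler0n R #|A|).
    by rewrite ger_pMl// mulr_ile1.
  have -> : \sum_j pr mu (P j) * b j =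
      \sum_j (ce j + eta) * pr mu (P j) - eta - K * \sum_(j | small j) pr mu (P j).
    rewrite -[X in _ - X - _]mulr1 -sumP1 (big_mkcond small)/= !mulr_sumr -!sumrB.
    by apply: eq_bigr => j _; rewrite /b; case: (small j); ring.
  lra.
have [M Mh] : exists M, forall m, (M <= m)%N -> m%:R * (h - eta) <= entropy mu T P m.
  have [|M Mh] := @entropy_eventually_ge _ P0 (h - eta) cT mP0; first by rewrite -/h; lra.
  exists M => m /Mh /le_trans; apply.
  by apply: (@entropy_refine _ _ _ mu T mT _ _ P0 P (fun j => j.1.1)) => // j x /PPa[].
have [|G [mG G0 GP]] := @typical_names _ _ _ mu T mT muT _ P b fP (h - eta)
    (c + 3 * eta) (ex_intro _ M Mh).
  by move: beta_ge; rewrite /eta; lra.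
exists delta, G; split=> // x Gx N.
have [n [Nn nP]] := GP x Gx N; exists n; split=> //.
have fC' j y : C j y -> ce j <= f y + eta.
  by move=> /fC; rewrite ler_norml => /andP[]; lra.
have cP : forall y : BX, exists j, P j y by have [] := fP.
have [E sepE EP] := separated_extraction cX cT (ltW delta0) cP PC clC diamC
   sepC fC' fdelta Keta nP.
exists E => //.
rewrite -(ler_pM2l (expR_gt0 (3 * (n%:R * eta)))) -expRD; apply: le_trans EP.
by rewrite ler_expR le_eqVlt; apply/orP; left; apply/eqP; ring.
Qed.

End growth.

(** * Almost every point *)

Section recurrence.
Context {R : realType} {X : metricType R} (x0 : X).
Local Notation BX := (borel_type X x0).
Variable mu : probability BX R.

(** Asking for infinitely many backward visits makes [J] exactly invariant, as [ergodic_measure]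
    requires; its mass is at least that of [G], hence one. *)
Lemma ergodic_recurrence (T S : X -> X) (G : set BX) :
  cancel T S -> cancel S T -> continuous S ->
  invariant_measure mu T -> ergodic_measure mu T ->
  measurable G -> 0 < pr mu G ->
  {ae mu, forall x : BX, exists j, G (iter j S x)}.
Proof.
move=> TS ST cS muT eT mG G0.
have mS := continuous_measurable_self (x0 := x0) cS.
have muS (A : set BX) : measurable A -> mu ((S : BX -> BX) @^-1` A) = mu A.
  move=> mA; rewrite -(muT ((S : BX -> BX) @^-1` A)).
    by congr (mu _); apply/seteqP; split=> x /=; rewrite TS.
  exact: (measurable_iter_preimage mS 1).
have mF i := measurable_iter_preimage mS i mG.
pose J := lim_sup_set (fun j => iter j (S : BX -> BX) @^-1` G).
have mJ : measurable J by apply: bigcap_measurable => // n _; exact: bigcup_measurable.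
have TJ : T @^-1` J = J.
  apply/seteqP; split=> [x Jx n _|x Jx n _].
    have [[//|j] /= nj] := Jx n.+1 Logic.I.
    by rewrite -iterS iterSr TS => Gj; exists j.
  have [j /= nj Gj] := Jx n Logic.I; exists j.+1; first exact: leqW.
  by rewrite /= -iterS iterSr TS.
have J0 : pr mu G <= pr mu J.
  by apply: pr_lim_sup_set_ge => // i; rewrite (pr_iter_preimage mS muS).
have J1 : mu J = 1%E.
  by case: (eT J mJ TJ) => // mJ0; move: J0; rewrite leNgt /pr mJ0 /= -/(pr mu G) G0.
exists (~` J); split; first exact: measurableC.
  by rewrite probability_setC// J1 subee.
move=> x /= Hx Jx; apply: Hx.
by have [j _ Gj] := Jx 0%N Logic.I; exists j.
Qed.

End recurrence.

(** * Monotonicity and lower bounds for the pressure *)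

Section pressure_bounds.
Context {R : realType} {X : metricType R}.
Variables (T : X -> X) (f : X -> R).

(* [T^j] maps [W^s(y)] into [W^s(x)], so separated subsets of [T^-n W^s(y)]
   lie in [T^-(n+j) W^s(x)]. *)
Lemma growth_transfer (F delta eps c c' : R) (x y : X) j :
  (forall z, `|f z| <= F) -> c' < c -> iter j T y = x ->
  (forall N, exists n, (N <= n)%N /\
    exists2 E : seq X, Defs.separated T n delta (iter n T @^-1` stable_set T eps y) E &
      expR (n%:R * c) <= \sum_(z <- E) expR (birk_sum T f n z)) ->
  forall N, exists n, (N <= n)%N /\
    exists2 E : seq X, Defs.separated T n delta (iter n T @^-1` stable_set T eps x) E &
      expR (n%:R * c') <= \sum_(z <- E) expR (birk_sum T f n z).
Proof.
move=> fF cc' yx H N.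
have F0 : 0 <= F by exact: le_trans (fF x).
(* Beyond [B] the gain [n%:R * (c - c')] covers the [j] extra terms, each costing at most [F] plus
   the absolute value of [c']. *)
pose B := j%:R * (F + `|c'|) / (c - c').
have B0 : 0 <= B by apply: divr_ge0; [rewrite mulr_ge0 ?addr_ge0|lra].
have [n [Nn [E [uE [KE sepE]] EP]]] := H (maxn N (Num.bound B)).
exists (n + j)%N; split.
  by apply: leq_trans (leq_addr _ _); apply: leq_trans Nn; exact: leq_maxl.
exists E.
  split=> //; split=> [z /KE zK i|z z' zE zE' zz'].
    have := zK (i + j)%N.
    by rewrite iterD yx /= -!iterD -[(i + j + n)%N]addnA [(j + n)%N]addnC.
  apply: lt_le_trans (sepE z z' zE zE' zz') _.
  apply: bowen_dist_le; first by exact: bigmax_ge_id.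
  by move=> i ni; apply: le_bowen_dist; exact: ltn_addr.
have nB : B <= n%:R.
  apply: ltW; apply: lt_le_trans (archi_boundP B0) _.
  by rewrite ler_nat; apply: leq_trans Nn; exact: leq_maxr.
have sumj z : birk_sum T f n z - j%:R * F <= birk_sum T f (n + j) z.
  rewrite /birk_sum big_split_ord/= lerD2l.
  rewrite -mulrN -[j in j%:R]card_ord -sumr_const mulr_suml; apply: ler_sum => i _.
  rewrite mul1r; have := fF (iter (n + i) T z); rewrite ler_norml; lra.
apply: (@le_trans _ _ (expR (- (j%:R * F)) * expR (n%:R * c))).
  rewrite -expRD ler_expR natrD mulrDl.
  move: nB; rewrite /B ler_pdivrMr ?subr_gt0// => nB.
  have : j%:R * c' <= j%:R * `|c'| by rewrite ler_wpM2l// ler_norm.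
  move: nB; rewrite mulrDr mulrBr; lra.
apply: (le_trans (ler_wpM2l (expR_ge0 _) EP)).
rewrite mulr_sumr; apply: ler_sum => z _.
by rewrite -expRD ler_expR; have := sumj z; lra.
Qed.

Lemma eln_le (a b : \bar R) : (a <= b)%E -> (eln a <= eln b)%E.
Proof.
case: a => [a||]; case: b => [b||] //=; rewrite ?leey ?leNye//.
rewrite lee_fin => ab; case: ifPn => a0; last by rewrite leNye.
by rewrite (lt_le_trans a0 ab) lee_fin ler_ln ?posrE// (lt_le_trans a0 ab).
Qed.

Lemma limn_esup_ge (u : (\bar R)^nat) (l : \bar R) :
  (forall N, exists2 n, (N <= n)%N & (l <= u n)%E) -> (l <= limn_esup u)%E.
Proof.
move=> H; rewrite limn_esup_lim; apply: lime_ge; first exact: is_cvg_esups.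
apply: nearW => N; have [n Nn ln] := H N.
by apply: le_trans ln _; apply: ereal_sup_ubound; exists n.
Qed.

Lemma limn_esup_mono (u v : (\bar R)^nat) : (forall n, (u n <= v n)%E) ->
  (limn_esup u <= limn_esup v)%E.
Proof.
move=> uv; rewrite !limn_esup_lim; apply: lee_lim; try exact: is_cvg_esups.
apply: nearW => N; apply: ge_ereal_sup => _ [n /= Nn <-].
by apply: le_trans (uv n) _; apply: ereal_sup_ubound; exists n.
Qed.

Definition growth_rate (K : nat -> set X) (delta : R) : \bar R :=
  limn_esup (fun n : nat => ((n%:R)^-1)%:E * eln (Pn T f delta (K n) n))%E.

Lemma Pn_le delta delta' (K K' : set X) n : delta' <= delta -> K `<=` K' ->
  (Pn T f delta K n <= Pn T f delta' K' n)%E.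
Proof.
move=> dd' KK'; apply: le_ereal_sup => _ [E [uE [KE sE]] <-].
exists E => //; split=> //; split=> [x /KE/KK'//|x y xE yE xy].
by apply: le_lt_trans dd' _; exact: sE.
Qed.

Lemma growth_rate_le delta delta' (K K' : nat -> set X) : delta' <= delta ->
  (forall n, K n `<=` K' n) -> (growth_rate K delta <= growth_rate K' delta')%E.
Proof.
move=> dd' KK'; apply: limn_esup_mono => n.
apply: lee_wpmul2l; first by rewrite lee_fin invr_ge0.
by apply: eln_le; exact: Pn_le.
Qed.

(** Separation at a smaller scale is a weaker demand, so the rate is monotone in [delta] and the
    limit in [Ps] is a genuine one. *)
Lemma is_cvg_growth_rate K : cvg (growth_rate K delta @[delta --> 0^'+]).
Proof.
apply: nonincreasing_at_right_is_cvge; apply: nearW => x d d' _ _ dd'.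
by apply: growth_rate_le => // n.
Qed.

Lemma growth_rate_ge delta c (K : nat -> set X) :
  (forall N, exists n, (N <= n)%N /\ exists2 E : seq X, Defs.separated T n delta (K n) E &
    expR (n%:R * c) <= \sum_(z <- E) expR (birk_sum T f n z)) ->
  (c%:E <= growth_rate K delta)%E.
Proof.
(* Starting from [N.+1] makes [n] positive, hence invertible. *)
move=> H; apply: limn_esup_ge => N; have [n [Nn [E sE EP]]] := H N.+1.
exists n; first exact: ltnW.
have n0 : (0 < n)%N by exact: leq_trans Nn.
have -> : c%:E = (n%:R^-1%:E * eln (expR (n%:R * c))%:E)%E.
  by rewrite /= expR_gt0 expRK -EFinM mulKf// pnatr_eq0 -lt0n.
apply: lee_wpmul2l; first by rewrite lee_fin invr_ge0.
apply: eln_le; apply: (@le_trans _ _ (\sum_(z <- E) expR (birk_sum T f n z))%:E).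
  by rewrite lee_fin.
by apply: ereal_sup_ubound; exists E.
Qed.

Lemma PsE x eps : Ps T f x eps =
  lim (growth_rate (fun n => iter n T @^-1` stable_set T eps x) delta @[delta --> 0^'+]).
Proof. by []. Qed.

Lemma Ps_ge x eps delta c : 0 < delta ->
  (forall N, exists n, (N <= n)%N /\ exists2 E : seq X,
    Defs.separated T n delta (iter n T @^-1` stable_set T eps x) E &
    expR (n%:R * c) <= \sum_(z <- E) expR (birk_sum T f n z)) ->
  (c%:E <= Ps T f x eps)%E.
Proof.
move=> d0 /growth_rate_ge H; rewrite PsE.
apply: lime_ge; first exact: is_cvg_growth_rate.
near=> d; apply: le_trans H _; apply: growth_rate_le => [|n]; last exact: subset_refl.
near: d; exact: nbhs_right_le.
Unshelve. all: by end_near. Qed.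

Lemma Ps_le x eps eps' : eps <= eps' -> (Ps T f x eps <= Ps T f x eps')%E.
Proof.
move=> ee'; rewrite !PsE; apply: lee_lim; try exact: is_cvg_growth_rate.
apply: nearW => d; apply: growth_rate_le => // n y Ky i.
exact: le_trans (Ky i) ee'.
Qed.

Lemma lim_Ps_ge x (p : \bar R) : (forall eps, 0 < eps -> (p <= Ps T f x eps)%E) ->
  (p <= lim (Ps T f x eps @[eps --> 0^'+]))%E.
Proof.
move=> H; apply: lime_ge.
  apply: nondecreasing_at_right_is_cvge; apply: nearW => e d d' _ _ dd'.
  exact: Ps_le.
near=> e; apply: H; near: e; exact: nbhs_right_gt.
Unshelve. all: by end_near. Qed.

End pressure_bounds.

(** * The almost sure bound at a fixed level *)

Section ae_bound.
Context {R : realType} {X : metricType R} (x0 : X).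
Local Notation BX := (borel_type X x0).
Variable mu : probability BX R.

(** Some partition nearly realizes the entropy and gives growth on a set of positive measure; almost
    every point has a backward iterate there, from which the growth is transferred. *)
Lemma ae_Ps_ge (T : X -> X) (f : X -> R) (eps c : R) :
  compact [set: X] -> homeomorphism T -> continuous f ->
  invariant_measure mu T -> ergodic_measure mu T -> 0 < eps ->
  (c%:E < ms_pressure mu T f)%E ->
  {ae mu, forall x : BX, (c%:E <= Ps T f x eps)%E}.
Proof.
move=> cX [cT [S [TS ST cS]]] cf muT eT eps0.
have [F F0 fF] := bounded_compact cX cf.
have mf := continuous_measurable_real (x0 := x0) cf.
have := integrable_fin_num measurableT (@bounded_integrable _ _ _ mu f F _ measurableT mf fF).
rewrite /ms_pressure; set phi := (\int[mu]_x _)%E => phifin.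
rewrite -lteBlDr// -(fineK phifin) -EFinB => /ereal_sup_gt[_ [P mP <-]].
rewrite lte_fin ltrBlDr => cP.
(* A midpoint, since [growth_transfer] has to start from a strictly larger rate. *)
pose c1 := (c + (partition_entropy mu T (projT2 P) + fine phi)) / 2.
have cc1 : c < c1 by rewrite /c1; lra.
have c1P : (c1%:E < (partition_entropy mu T (projT2 P))%:E + phi)%E.
  by rewrite -(fineK phifin) -EFinD lte_fin /c1; lra.
have [delta [G [delta0 mG G0 GP]]] := positive_measure_growth cX cT cf muT mP eps0 c1P.
apply: filterS (ergodic_recurrence TS ST cS muT eT mG G0) => x [j Gj].
apply: (Ps_ge delta0); apply: (growth_transfer fF cc1 _ (GP _ Gj) (j := j)).
by elim: j {Gj} => // j IH; rewrite iterSr iterS ST.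
Qed.

End ae_bound.

(** Countably many levels stand in for [p], so that almost-everywhere statements can be combined;
    this covers infinite entropy too. *)
Lemma ge_approx {R : realType} (p : \bar R) : exists l : nat -> \bar R,
  (forall n, l n = -oo%E \/ exists2 c, l n = c%:E & (c%:E < p)%E) /\
  forall y, (forall n, (l n <= y)%E) -> (p <= y)%E.
Proof.
case: p => [r||].
- exists (fun n => (r - n.+1%:R^-1)%:E); split=> [n|y H].
    by right; exists (r - n.+1%:R^-1) => //; rewrite lte_fin ltrBlDr ltrDl invr_gt0.
  apply/lee_subgt0Pr => e e0; apply: le_trans (H (Num.bound e^-1)).
  by rewrite -EFinB lee_fin lerD2l lerN2 ltW// inv_boundS_lt.
- exists (fun n => n%:R%:E); split=> [n|y H].
    by right; exists n%:R => //; rewrite ltry.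
  rewrite leye_eq; apply/eqP/eq_infty => t; apply: le_trans (H (Num.bound `|t|)).
  rewrite lee_fin; apply: le_trans (ler_norm t) _.
  by apply: ltW; exact: archi_boundP.
- by exists (fun=> -oo%E); split=> [n|y _]; [left|rewrite leNye].
Qed.

Unset Implicit Arguments.
Set Strict Implicit.

(* X : compact metric space (point x0 only used to make the Borel measurable
   type pointed), T : homeomorphism, f continuous, mu ergodic invariant Borel
   probability measure with h_mu(T) > 0. *)
Theorem theorem3p6 (R : realType) (X : metricType R) (x0 : X)
  (T : X -> X) (f : X -> R) (mu : probability (borel_type X x0) R) :
  compact [set: X] ->
  homeomorphism T ->
  continuous f ->
  invariant_measure mu T ->
  ergodic_measure mu T ->
  (0 < ms_entropy mu T)%E ->
  {ae mu, forall x : borel_type X x0,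
     (ms_pressure mu T f <= lim (Ps T f x eps @[eps --> 0^'+]))%E}.
Proof.
move=> cX hT cf muT eT _.
have [l [lP lup]] := ge_approx (ms_pressure mu T f).
(* Countably many scales and levels suffice because [Ps] is monotone in [eps]. *)
suff H : {ae mu, forall x : borel_type X x0, forall q n : nat,
    (l n <= Ps T f x q.+1%:R^-1)%E}.
  apply: filterS H => x Hx; apply: lim_Ps_ge => eps eps0; apply: lup => n.
  apply: le_trans (Hx (Num.bound eps^-1) n) _; apply: Ps_le.
  by rewrite ltW// inv_boundS_lt.
apply: ae_foralln => q; apply: ae_foralln => n.
have [->|[c -> cp]] := lP n; first by apply: aeW => x; rewrite leNye.
by apply: ae_Ps_ge.
Qed.
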